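(* Let $\{x^k\}$ be the primal sequence generated by the inexact Newton method, let $$\lambda(x^k)=\sqrt{(\Delta x^k)'\nabla^2 f(x^k)\Delta x^k},\qquad\tilde\lambda(x^k)=\sqrt{(\Delta\tilde x^k)'\nabla^2 f(x^k)\Delta\tilde x^k}$$ be the exact and inexact Newton decrements at $x^k$, let $f(x^k)$ be the objective function value at the $k$-th iteration, and let $f^*$ be the optimal value of the problem of minimizing $f(x)$ subject to $Ax=c$. Let $\bar k$ be the iteration index with $\theta^{\bar k}<V$, so that $d^k=1$ for all $k\ge\bar k$. Let $\phi$ be a positive scalar with $\phi\le0.267$ and set $$\xi=\frac{\phi p+\sqrt\epsilon}{1-p-\phi-\sqrt\epsilon}+\frac{2\phi\sqrt\epsilon+\epsilon}{(1-p-\phi-\sqrt\epsilon)^2},\qquad v=\frac{1}{(1-p-\phi-\sqrt\epsilon)^2}.$$ Assume that the following relations hold: $$(1+p)(\theta^{\bar k}+\bar\tau)+\sqrt\epsilon\le\phi,\qquad v(0.68)^2+\xi\le0.68,\qquad\frac{0.68+\sqrt\epsilon}{1-p}\le1,\qquad p+\sqrt\epsilon\le1-(4\phi^2)^{1/4}-\phi,$$ where $\bar\tau>0$ is a bound on the error in the Newton decrement calculation at step $\bar k$, i.e. $|\tilde\lambda(x^{\bar k})-\theta^{\bar k}|\le\bar\tau$. Assume moreover that for some $\delta\in[0,1/2)$, $$\xi+v\xi\le\frac{\delta}{4v}.$$ Then for all $m\ge1$, $$\lambda(x^{\bar k+m})\le\frac{1}{2^{2^m}v}+\xi+\frac{\delta}{v}\,\frac{2^{2^m-1}-1}{2^{2^m}},$$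 and $$\limsup_{m\to\infty}f(x^{\bar k+m})-f^*\le\xi+\frac{\delta}{2v}.$$
   Context: Let $R\in\{0,1\}^{L\times S}$ be the routing matrix of a network with links $\{1,\dots,L\}$ of capacities $c_l>0$ and sources $\{1,\dots,S\}$ ($R_{ij}=1$ if and only if link $i$ is on the route of source $j$); each source uses at least one link, each link is used by at least one source, and the links form a connected graph. Let $A=[R\ \ I(L)]$. Utilities $U_i:\mathbb{R}_+\to\mathbb{R}$ are strictly concave and nondecreasing on $(0,\infty)$, with $-U_i$ self-concordant on $(0,\infty)$ (three times continuously differentiable, convex, and $|g'''|\le 2(g'')^{3/2}$ for $g=-U_i$). For fixed $\mu\ge1$, let $f(x)=-\sum_{i=1}^{S}U_i(x_i)-\mu\sum_{i=1}^{S+L}\log x_i$ on the positive orthant of $\mathbb{R}^{S+L}$; its Hessian there is diagonal and positive definite. Inexact Newton method for minimizing $f(x)$ subject to $Ax=c$: $x^0$ is strictly positive with $Ax^0=c$, and $x^{k+1}=x^k+d^k\Delta\tilde x^k$. All iterates $x^k$ are strictly positive and feasible. The exact Newton direction $\Delta x^k$ is determined by $\nabla^2 f(x^k)\Delta x^k+A'w^k=-\nabla f(x^k)$ and $A\Delta x^k=0$ for some $w^k\in\mathbb{R}^L$. The inexact direction is $\Delta\tilde x^k=\begin{pmatrix}\Delta\tilde s^k\\-R\Delta\tilde s^k\end{pmatrix}$ (so $A\Delta\tilde x^k=0$), where $\Delta\tilde s_i^k=-(H_k)_{ii}^{-1}\bigl(\nabla_i f(x^k)+(R'\tilde w^k)_i\bigr)$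 for $i=1,\dots,S$, $H_k=\nabla^2 f(x^k)$, and $\tilde w^k$ is an approximation of $w^k$. Error in direction: with $\gamma^k=\Delta x^k-\Delta\tilde x^k$, there are scalars $0<p<1$ and $\epsilon>0$ such that for all $k$, $|(\gamma^k)'\nabla^2 f(x^k)\gamma^k|\le p^2(\Delta\tilde x^k)'\nabla^2 f(x^k)\Delta\tilde x^k+\epsilon$. Stepsize rule: $V$ and $b$ are fixed scalars with $0<V<0.267$ and $\frac{V+1}{2V+1}<b<1$. The scalar $\theta^k$ is an approximation of $\tilde\lambda(x^k)$ with $|\tilde\lambda(x^k)-\theta^k|\le\left(\frac1b-1\right)(1+V)$ for all $k$. The stepsize is $d^k=\frac{b}{\theta^k+1}$ as long as all values of $\theta$ computed so far are at least $V$, and $d^k=1$ from the first index $\bar k$ with $\theta^{\bar k}<V$ onwards. *)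

(* Defs.v *)
From HB Require Import structures.
From mathcomp Require Import all_boot all_order all_algebra.
From mathcomp Require Import all_classical all_reals all_analysis.

Set Implicit Arguments.
Unset Strict Implicit.
Unset Printing Implicit Defensive.

Import Order.TTheory GRing.Theory Num.Theory.
Import numFieldNormedType.Exports.

Local Open Scope classical_set_scope.
Local Open Scope ring_scope.

(* The links are the edges of a multigraph on the nodes: link l joins tail l
   and head l.  Orientation is irrelevant for connectedness. *)
Definition link_adj (L : nat) (node : finType) (tail head : 'I_L -> node) :
    rel node :=
  fun u v => [exists l, ((tail l == u) && (head l == v))
                     || ((tail l == v) && (head l == u))].

Definition links_connected (L : nat) (node : finType)
    (tail head : 'I_L -> node) : Prop :=
  forall u v : node, connect (link_adj tail head) u v.

Definition routing_mx (R : realType) (L S : nat) (route : 'I_S -> {set 'I_L}) :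
    'M[R]_(L, S) :=
  \matrix_(l, j) (l \in route j)%:R.

Definition constraint_mx (R : realType) (L S : nat)
    (route : 'I_S -> {set 'I_L}) : 'M[R]_(L, S + L) :=
  row_mx (routing_mx R route) 1%:M.

Section Utilities.
Variable R : realType.
Implicit Types (D : set R) (g : R -> R).

Definition nondecreasing_on D g : Prop :=
  forall x y, D x -> D y -> x <= y -> g x <= g y.

Definition strictly_concave_on D g : Prop :=
  forall x y t, D x -> D y -> x != y -> 0 < t -> t < 1 ->
    t * g x + (1 - t) * g y < g (t * x + (1 - t) * y).

(* D is meant to be open; derivatives and continuity are then those of g
   itself at the points of D. *)
Definition continuously_differentiable3_on D g : Prop :=
  forall x, D x ->
    (forall n, (n < 3)%N -> derivable (derive1n n g) x 1) /\
    {for x, continuous (derive1n 3 g)}.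

Definition self_concordant_on D g : Prop :=
  [/\ continuously_differentiable3_on D g,
      convex_function D g &
      forall x, D x -> `|derive1n 3 g x| <= 2 * (derive1n 2 g x) `^ (3 / 2)].

End Utilities.

Section Derivatives.
Variables (R : realType) (n : nat).
Implicit Types (f : 'cV[R]_n -> R) (x u : 'cV[R]_n) (H : 'M[R]_n).

Definition grad f x : 'cV[R]_n := \col_i 'D_(delta_mx i 0) f x.

Definition hessian f x : 'M[R]_n :=
  \matrix_(i, j) 'D_(delta_mx i 0) ('D_(delta_mx j 0) f) x.

Definition quad H u : R := (u^T *m H *m u) 0 0.

(* The decrement at x of a direction u: exact or inexact according to u. *)
Definition decrement f x u : R := Num.sqrt (quad (hessian f x) u).

Definition positive_cV x : Prop := forall i, 0 < x i 0.

End Derivatives.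

Section Problem.
Variables (R : realType) (L S : nat).

Definition objective (U : 'I_S -> R -> R) (mu : R) (x : 'cV[R]_(S + L)) : R :=
  - (\sum_(i < S) U i (x (lshift L i) 0)) - mu * \sum_(i < S + L) ln (x i 0).

(* The objective lives on the positive orthant, so only strictly positive
   points compete in the minimization. *)
Definition feasible (route : 'I_S -> {set 'I_L}) (c : 'cV[R]_L) :
    set 'cV[R]_(S + L) :=
  [set x | positive_cV x /\ constraint_mx R route *m x = c].

Definition optimal_value (f : 'cV[R]_(S + L) -> R)
    (X : set 'cV[R]_(S + L)) : \bar R :=
  ereal_inf [set (f x)%:E | x in X].

Definition is_newton_direction (A : 'M[R]_(L, S + L))
    (f : 'cV[R]_(S + L) -> R) (x dx : 'cV[R]_(S + L)) : Prop :=
  (exists w : 'cV[R]_L, hessian f x *m dx + A^T *m w = - grad f x) /\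
  A *m dx = 0.

(* wt is the approximate dual vector *)
Definition inexact_source_direction (route : 'I_S -> {set 'I_L})
    (f : 'cV[R]_(S + L) -> R) (x : 'cV[R]_(S + L)) (wt : 'cV[R]_L) :
    'cV[R]_S :=
  \col_(i < S) (- ((hessian f x) (lshift L i) (lshift L i))^-1 *
     (grad f x (lshift L i) 0 + ((routing_mx R route)^T *m wt) i 0)).

Definition inexact_direction (route : 'I_S -> {set 'I_L})
    (f : 'cV[R]_(S + L) -> R) (x : 'cV[R]_(S + L)) (wt : 'cV[R]_L) :
    'cV[R]_(S + L) :=
  let ds := inexact_source_direction route f x wt in
  col_mx ds (- (routing_mx R route *m ds)).

End Problem.

Definition stepsize (R : realType) (b V : R) (theta : nat -> R) (k : nat) : R :=
  if [forall j : 'I_k.+1, V <= theta j] then b / (theta k + 1) else 1.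

(* Main.v *)
Require Import Defs.
From HB Require Import structures.
From mathcomp Require Import all_boot all_order all_algebra.
From mathcomp Require Import all_classical all_reals all_analysis.
From mathcomp Require Import ring lra.
Import Order.TTheory GRing.Theory Num.Theory.
Import numFieldNormedType.Exports.
Local Open Scope classical_set_scope.
Local Open Scope ring_scope.

(** The objective is a sum of functions of one coordinate, so every estimate
    reduces to one dimension, where self-concordance means that [g''^(-1/2)] is
    1-Lipschitz.  Testing the Newton equations at [x] and at [x + dy] against
    the next exact direction gives, for a full step with inexact decrement
    [t < 1] and direction error at most [p t + e], [e = sqrt epsilon],
      [lambda+ (1 - t) <= p t + e + t^2 / (1 - t)].
    Since [t (1 - p) <= lambda + e], a bound [lambda <= A] on the current
    decrement yields
      [lambda+ <= (lambda + e)^2 / D_A^2 + (p lambda + e) / D_A],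
    with [D_A = 1 - p - A - e]; for [A = phi] the right-hand side is at most
    [v lambda^2 + xi].

    The level [phi] need not be preserved by this recursion.  If
    [v phi^2 + xi <= phi], it is, and the quadratic recursion gives the bound by
    induction on [m].  Otherwise [phi < 2 xi], the level [A = 3 xi] is preserved,
    and [3 xi] is below the claimed bound because [delta >= 4 v xi (1 + v)].

    For the objective values, [f x - f y <= lambda(x)^2] holds for all feasible
    [x] and [y] as soon as [lambda(x) <= 1/2], which the bound on the decrement
    guarantees for [m >= 1]; finally [lambda^2 <= lambda]. *)

(** * Self-concordant functions of one variable *)

(** The mean value theorem for [G - F]. It replaces integration: each integral bound below becomes a
    comparison of derivatives along a segment parametrized by [0, 1]. *)
Lemma increment_le_of_derive_le {R : realType} (F G dF dG : R -> R) :
  (forall s : R, 0 <= s <= 1 -> is_derive s 1 F (dF s)) ->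
  (forall s : R, 0 <= s <= 1 -> is_derive s 1 G (dG s)) ->
  (forall s : R, 0 <= s <= 1 -> dF s <= dG s) ->
  F 1 - F 0 <= G 1 - G 0.
Proof.
move=> FdF GdG dFG.
have dH (s : R) : 0 <= s <= 1 -> is_derive s 1 (G - F) (dG s - dF s).
  by move=> s01; have := FdF _ s01; have := GdG _ s01 => ? ?; exact: is_deriveB.
have := @MVT_segment R (G - F) (fun s => dG s - dF s) 0 1 ler01.
case.
- by move=> s; rewrite in_itv/= => /andP[s0 s1]; apply: dH; rewrite !ltW.
- apply: derivable_within_continuous => s; rewrite in_itv/= => s01.
  by have := dH _ s01 => ?; exact: ex_derive.
- move=> s; rewrite in_itv/= => /dFG dFGs; rewrite subr0 mulr1 !fctE => E.
  lra.
Qed.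

Lemma is_derive_affine {R : realType} (x u s : R) :
  is_derive s 1 (fun t : R => x + t * u) u.
Proof.
have := is_deriveD (is_derive_cst x s 1) (is_deriveZ u (is_derive_id s 1)).
rewrite add0r [u *: 1]mulr1; set F := (F in is_derive _ _ F _ -> _).
by have -> : F = (fun t => x + t * u) by apply/funext => t; rewrite /F /= mulrC.
Qed.

Lemma is_derive1_line {R : realType} (g : R -> R) (x u s dg : R) :
  is_derive (x + s * u) 1 g dg ->
  is_derive s 1 (fun t => g (x + t * u)) (dg * u).
Proof.
move=> gd; have lind : is_derive s 1 (fun t => x + t * u) u.
  exact: is_derive_affine.
exact: (@is_derive1_comp _ g (fun t : R => x + t * u)).
Qed.

Lemma is_derive_inv_affine {R : realType} (k r s : R) : 1 + s * r != 0 ->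
  is_derive s 1 (fun t : R => k / (1 + t * r)) (- (k * r / (1 + s * r) ^+ 2)).
Proof.
move=> nz; have aff := is_derive_affine 1 r s.
have := is_deriveZ k (@is_deriveV _ (fun t : R => 1 + t * r) s r 1 nz aff).
set D := (D in is_derive _ _ _ D -> _).
have -> // : D = - (k * r / (1 + s * r) ^+ 2).
by rewrite /D /GRing.scale/=; field.
Qed.

(** Compare the derivatives of [- ln (1 - t q)] and [t q + (t q)^2]: cleared of the denominator,
    they differ by [t q^2 (1 - 2 t q)], nonnegative because [q <= 1/2]. *)
Lemma ln_onem_ge {R : realType} (q : R) : 0 <= q <= 1 / 2 ->
  - ln (1 - q) <= q + q ^+ 2.
Proof.
move=> /andP[q0 q1].
have den (s : R) : 0 <= s <= 1 -> 0 < 1 + s * - q.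
  by move=> /andP[s0 s1]; nra.
pose G := (fun t : R => 0 + t * q) +
  (fun t : R => 0 + t * q) * (fun t : R => 0 + t * q).
have dF (s : R) : 0 <= s <= 1 ->
    is_derive s 1 (- (fun t : R => ln (1 + t * - q))) (- ((1 + s * - q)^-1 * - q)).
  move=> s01; apply: is_deriveN.
  by apply: is_derive1_line; apply: is_derive1_ln; exact: den.
have dG (s : R) : 0 <= s <= 1 ->
    is_derive s 1 G (q + ((0 + s * q) *: q + (0 + s * q) *: q)).
  move=> s01; apply: is_deriveD; first exact: is_derive_affine.
  by apply: is_deriveM; exact: is_derive_affine.
have := increment_le_of_derive_le _ G _ _ dF dG.
rewrite /G !fctE !mul1r !mul0r !addr0 !add0r ln1 oppr0 !mulr0 !subr0 => H.
suff : - ln (1 - q) <= q + q * q by rewrite expr2.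
apply: H => s /[dup] /den d0 /andP[s0 s1].
rewrite mulrN opprK -[leLHS]mulrC ler_pdivrMr// /GRing.scale/= !add0r.
have -> : (q + (s * q * q + s * q * q)) * (1 + s * - q) =
  q + s * q ^+ 2 * (1 - 2 * (s * q)) by ring.
by rewrite lerDl mulr_ge0 ?mulr_ge0 ?exprn_ge0//; nra.
Qed.

(** A Fenchel-Young inequality: the conjugate of [r - ln (1 + r)] is [- q - ln (1 - q)], here at
    most [q^2]. It comes from [ln z <= z - 1] at [z = (1 + r) (1 - q)]. *)
Lemma damping_tradeoff {R : realType} (q r : R) : 0 <= q <= 1 / 2 -> 0 <= r ->
  q * r <= r - ln (1 + r) + q ^+ 2.
Proof.
move=> q01 r0; have /andP[q0 q1] := q01.
have p1 : 0 < 1 - q by lra.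
have p2 : 0 < 1 + r by lra.
have := le_ln1Dx (x := (1 + r) * (1 - q) - 1).
rewrite addrCA subrr addr0 lnM ?posrE// ltrBrDl subrr mulr_gt0// => /(_ isT).
have := ln_onem_ge q q01; lra.
Qed.

Lemma line_gt0 {R : realType} (x u s : R) :
  0 < x -> 0 < x + u -> 0 <= s <= 1 -> 0 < x + s * u.
Proof.
move=> x0 xu0 /andP[]; rewrite le_eqVlt => /predU1P[<- _|s0 s1].
  by rewrite mul0r addr0.
have -> : x + s * u = (1 - s) * x + s * (x + u) by ring.
by rewrite ltr_wpDl ?mulr_ge0 ?mulr_gt0 ?subr_ge0// ltW.
Qed.

(** The derivatives are given as explicit functions, so that those of the logarithm stay in closed
    form. The product [g2 * sqrt g2] is the power 3/2, and [0 < g2] permits division by the root. *)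
Definition self_concordant_jet {R : realType} (g g1 g2 g3 : R -> R) : Prop :=
  forall t : R, 0 < t ->
  [/\ is_derive t 1 g (g1 t), is_derive t 1 g1 (g2 t), is_derive t 1 g2 (g3 t),
      0 < g2 t & `|g3 t| <= 2 * (g2 t * Num.sqrt (g2 t))].

Section Jet.
Context {R : realType}.
Variables (g g1 g2 g3 : R -> R).
Hypothesis sc : self_concordant_jet g g1 g2 g3.

Lemma sc_sqrt_gt0 t : 0 < t -> 0 < Num.sqrt (g2 t).
Proof. by move=> /sc[_ _ _ ? _]; rewrite sqrtr_gt0. Qed.

Lemma sc_sqrt_sqr t : 0 < t -> Num.sqrt (g2 t) ^+ 2 = g2 t.
Proof. by move=> /sc[_ _ _ /ltW ? _]; rewrite sqr_sqrtr. Qed.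

(* Self-concordance says exactly that [(g2)^(-1/2)] has derivative at most 1 in
   absolute value. *)
Lemma sc_invsqrt_lipschitz x u : 0 < x -> 0 < x + u ->
  `|(Num.sqrt (g2 (x + u)))^-1 - (Num.sqrt (g2 x))^-1| <= `|u|.
Proof.
move=> x0 xu0.
pose sg t := (Num.sqrt (g2 t))^-1.
pose dsg t := - (Num.sqrt (g2 t)) ^- 2 * ((2 * Num.sqrt (g2 t))^-1 * g3 t).
have sgd (t : R) : 0 < t -> is_derive t 1 sg (dsg t).
  move=> t0; have [_ _ d3 g20 _] := sc _ t0.
  have sq0 := sc_sqrt_gt0 _ t0.
  apply: (@is_deriveV _ (fun t => Num.sqrt (g2 t))); first by rewrite gt_eqF.
  exact: (is_derive1_comp (is_derive1_sqrt g20) d3).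
have dsg1 t : 0 < t -> `|dsg t| <= 1.
  move=> t0; have [_ _ _ g20 g3le] := sc _ t0.
  have sq0 := sc_sqrt_gt0 _ t0.
  have -> : dsg t = - (g3 t / (2 * (g2 t * Num.sqrt (g2 t)))).
    move: (sc_sqrt_sqr _ t0) sq0; rewrite /dsg; move: (Num.sqrt _) => q <- q0.
    by field; rewrite gt_eqF.
  have den0 : 0 < 2 * (g2 t * Num.sqrt (g2 t)) by rewrite !mulr_gt0.
  by rewrite normrN normrM normfV (gtr0_norm den0) ler_pdivrMr// mul1r.
have pos s : 0 <= s <= 1 -> 0 < x + s * u by exact: line_gt0.
have bnd s : 0 <= s <= 1 -> - `|u| <= dsg (x + s * u) * u <= `|u|.
  move=> /pos/dsg1 d1; rewrite -ler_norml normrM ler_piMl//.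
have cstd (c s : R) : is_derive s 1 (fun t => t * c) c.
  have := is_derive_affine 0 c s.
  by congr is_derive; apply/funext => t; rewrite add0r.
have sgl (s : R) : 0 <= s <= 1 ->
    is_derive s 1 (fun t => sg (x + t * u)) (dsg (x + s * u) * u).
  by move=> /pos/sgd; exact: is_derive1_line.
have A := @increment_le_of_derive_le _ (fun t => sg (x + t * u))
  (fun t => t * `|u|) _ (fun=> `|u|) sgl (fun s _ => cstd _ s)
  (fun s h => proj2 (andP (bnd s h))).
have B := @increment_le_of_derive_le _ (fun t => t * - `|u|)
  (fun t => sg (x + t * u)) (fun=> - `|u|) _ (fun s _ => cstd _ s) sgl
  (fun s h => proj1 (andP (bnd s h))).
move: A B; rewrite !mul1r !mul0r !addr0 !subr0 -/(sg (x + u)) -/(sg x) => A B.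
by rewrite ler_norml A B.
Qed.

(** One side of the Lipschitz bound, cleared of denominators; [sc_sqrt_ge] is the other side. *)
Lemma sc_sqrt_le x u : 0 < x -> 0 < x + u ->
  Num.sqrt (g2 x) <= Num.sqrt (g2 (x + u)) * (1 + Num.sqrt (g2 x) * `|u|).
Proof.
move=> x0 xu0; have := sc_invsqrt_lipschitz x u x0 xu0.
rewrite ler_norml => /andP[_].
have := sc_sqrt_gt0 _ x0; have := sc_sqrt_gt0 _ xu0.
set a := Num.sqrt _; set b := Num.sqrt _ => a0 b0.
rewrite lerBlDr -[leLHS]mul1r ler_pdivrMr// => H.
have -> : b = b * 1 by rewrite mulr1.
have {H} : b * 1 <= b * ((`|u| + b^-1) * a) by rewrite ler_pM2l.
rewrite mulr1 => /le_trans; apply.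
by rewrite mulrA mulrDr divff ?gt_eqF// mulrC addrC.
Qed.

Lemma sc_sqrt_ge x u : 0 < x -> 0 < x + u -> Num.sqrt (g2 x) * `|u| < 1 ->
  Num.sqrt (g2 (x + u)) * (1 - Num.sqrt (g2 x) * `|u|) <= Num.sqrt (g2 x).
Proof.
move=> x0 xu0 r1; have := sc_invsqrt_lipschitz x u x0 xu0.
rewrite ler_norml => /andP[+ _].
have := sc_sqrt_gt0 _ x0; have := sc_sqrt_gt0 _ xu0.
set a := Num.sqrt _; set b := Num.sqrt _ in r1 * => a0 b0.
move=> H; have {H} H : b^-1 - `|u| <= a^-1 by lra.
have : a * b * (b^-1 - `|u|) <= a * b * a^-1 by rewrite ler_pM2l// mulr_gt0.
rewrite [a * b * a^-1]mulrAC divff ?gt_eqF// mul1r mulrBr mulfK ?gt_eqF//.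
by rewrite mulrBr mulr1 mulrA.
Qed.

(** By [sc_sqrt_le], [u^2 g2(x + s u) >= r^2 / (1 + s r)^2] along the segment. The right-hand side
    has antiderivative [- r / (1 + s r)], whose increment over [0, 1] is [r^2 / (1 + r)]. *)
Lemma sc_derive_gap_ge x u (r := Num.sqrt (g2 x) * `|u|) :
  0 < x -> 0 < x + u -> r ^+ 2 / (1 + r) <= u * (g1 (x + u) - g1 x).
Proof.
move=> x0 xu0.
have r0 : 0 <= r by rewrite mulr_ge0// sqrtr_ge0.
have den (s : R) : 0 <= s <= 1 -> 0 < 1 + s * r.
  by move=> /andP[s0 _]; rewrite ltr_wpDr// mulr_ge0.
have pos (s : R) : 0 <= s <= 1 -> 0 < x + s * u by exact: line_gt0.
have := @increment_le_of_derive_le _ (fun t => - r / (1 + t * r))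
  (fun t => u * g1 (x + t * u)) (fun s => - (- r * r / (1 + s * r) ^+ 2))
  (fun s => u * (g2 (x + s * u) * u)).
rewrite mul1r !mul0r !addr0 mul1r divr1 opprK -mulrBr.
have -> : - r / (1 + r) + r = r ^+ 2 / (1 + r).
  by field; rewrite gt_eqF// ltr_wpDr.
apply=> s s01.
- by apply: is_derive_inv_affine; rewrite gt_eqF// den.
- have [_ d2 _ _ _] := sc _ (pos _ s01).
  by have := is_deriveZ u (is_derive1_line _ _ _ _ _ d2).
- have := sc_sqrt_le x (s * u) x0 (pos _ s01).
  rewrite normrM ger0_norm ?(andP s01).1// mulrCA -/r => H.
  have q0 := sc_sqrt_gt0 _ (pos _ s01).
  rewrite -[X in u * (X * u)](sc_sqrt_sqr _ (pos _ s01)).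
  move: (Num.sqrt (g2 (x + s * u))) H q0 => q H q0.
  have -> : u * (q ^+ 2 * u) = (q * `|u|) ^+ 2.
    by rewrite exprMn real_normK ?num_real//; ring.
  rewrite !mulNr opprK -expr2 -expr_div_n ler_pXn2r ?nnegrE//.
  + by rewrite ler_pdivrMr ?den// /r mulrAC ler_wpM2r// den.
  + by rewrite divr_ge0// ltW ?den.
  + by rewrite mulr_ge0// ltW.
Qed.

(** The mirror argument, with [sc_sqrt_ge] and the antiderivative [r / (1 - s r)]. *)
Lemma sc_derive_gap_le x u (r := Num.sqrt (g2 x) * `|u|) :
  0 < x -> 0 < x + u -> r < 1 ->
  u * (g1 (x + u) - g1 x) <= r ^+ 2 / (1 - r).
Proof.
move=> x0 xu0 r1.
have r0 : 0 <= r by rewrite mulr_ge0// sqrtr_ge0.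
have den (s : R) : 0 <= s <= 1 -> 0 < 1 - s * r.
  by move=> /andP[s0 s1]; rewrite subr_gt0 (le_lt_trans _ r1)// ler_piMl.
have pos (s : R) : 0 <= s <= 1 -> 0 < x + s * u by exact: line_gt0.
have := @increment_le_of_derive_le _
  (fun t => u * g1 (x + t * u)) (fun t => r / (1 + t * - r))
  (fun s => u * (g2 (x + s * u) * u)) (fun s => - (r * - r / (1 + s * - r) ^+ 2)).
rewrite mul1r !mul0r !addr0 mul1r divr1 -mulrBr.
have -> : r / (1 - r) - r = r ^+ 2 / (1 - r).
  by field; rewrite subr_eq0 gt_eqF.
apply=> s s01.
- have [_ d2 _ _ _] := sc _ (pos _ s01).
  by have := is_deriveZ u (is_derive1_line _ _ _ _ _ d2).
- by apply: is_derive_inv_affine; rewrite mulrN gt_eqF// den.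
- have := sc_sqrt_ge x (s * u) x0 (pos _ s01).
  rewrite normrM ger0_norm ?(andP s01).1// mulrCA -/r => H.
  have sr1 : s * r < 1 by rewrite -subr_gt0 den.
  have {}H := H sr1.
  have q0 := sc_sqrt_gt0 _ (pos _ s01).
  rewrite -[X in u * (X * u)](sc_sqrt_sqr _ (pos _ s01)).
  move: (Num.sqrt (g2 (x + s * u))) H q0 => q H q0.
  have -> : u * (q ^+ 2 * u) = (q * `|u|) ^+ 2.
    by rewrite exprMn real_normK ?num_real//; ring.
  rewrite !mulrN !mulNr opprK -expr2 -expr_div_n ler_pXn2r ?nnegrE//.
  + by rewrite ler_pdivlMr ?den// /r mulrAC ler_wpM2r// den.
  + by rewrite mulr_ge0// ltW.
  + by rewrite divr_ge0// ltW ?den.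
Qed.

(** Multiplied by [u], the remainder is [w - r^2], where the two gap bounds place [w] between
    [r^2 / (1 + r)] and [r^2 / (1 - r)]. Both ends are within [r^3 / (1 - r)] of [r^2]. *)
Lemma sc_newton_remainder x u (r := Num.sqrt (g2 x) * `|u|) :
  0 < x -> 0 < x + u -> r < 1 ->
  `|g1 (x + u) - g1 x - g2 x * u| <= Num.sqrt (g2 x) * (r ^+ 2 / (1 - r)).
Proof.
move=> x0 xu0 r1.
have r0 : 0 <= r by rewrite mulr_ge0// sqrtr_ge0.
have [u0|u0] := eqVneq u 0.
  rewrite u0 addr0 subrr mulr0 subrr normr0.
  by rewrite mulr_ge0 ?sqrtr_ge0// divr_ge0 ?exprn_ge0// subr_ge0 ltW.
have up : 0 < `|u| by rewrite normr_gt0.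
rewrite -(ler_pM2l up) -normrM [`|u| * (_ * _)]mulrA [`|u| * Num.sqrt _]mulrC -/r.
have := sc_derive_gap_le x u x0 xu0 r1.
have := sc_derive_gap_ge x u x0 xu0.
rewrite -/r; set w := u * _ => wge wle.
have -> : u * (g1 (x + u) - g1 x - g2 x * u) = w - r ^+ 2.
  rewrite /r exprMn (sc_sqrt_sqr _ x0) real_normK ?num_real//.
  by rewrite /w; ring.
have E1 : r ^+ 2 / (1 - r) = r ^+ 2 + r * (r ^+ 2 / (1 - r)).
  by field; rewrite subr_eq0 gt_eqF.
have E2 : r ^+ 2 / (1 + r) = r ^+ 2 - r * (r ^+ 2 / (1 + r)).
  by field; rewrite gt_eqF// ltr_wpDr.
have E3 : r * (r ^+ 2 / (1 + r)) <= r * (r ^+ 2 / (1 - r)).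
  have d1 : 0 < 1 - r by rewrite subr_gt0.
  have d2 : 0 < 1 + r by rewrite ltr_wpDr.
  rewrite !ler_wpM2l ?exprn_ge0// lef_pV2 ?posrE//.
  by rewrite lerD2l (le_trans _ r0)// oppr_le0.
by rewrite ler_norml; apply/andP; split; lra.
Qed.

(** A second integration: [sc_derive_gap_ge] at [s u], divided by [s], bounds the slope from below
    by [s r^2 / (1 + s r) = r - r / (1 + s r)], the derivative of [s r - ln (1 + s r)]. *)
Lemma sc_lower_bound x u (r := Num.sqrt (g2 x) * `|u|) :
  0 < x -> 0 < x + u ->
  g x + g1 x * u + (r - ln (1 + r)) <= g (x + u).
Proof.
move=> x0 xu0.
have r0 : 0 <= r by rewrite mulr_ge0// sqrtr_ge0.
have den (s : R) : 0 <= s <= 1 -> 0 < 1 + s * r.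
  by move=> /andP[s0 _]; rewrite ltr_wpDr// mulr_ge0.
have pos (s : R) : 0 <= s <= 1 -> 0 < x + s * u by exact: line_gt0.
pose F := (fun t : R => 0 + t * r) - (fun t : R => ln (1 + t * r)).
pose G := (fun t : R => g (x + t * u)) - (fun t : R => 0 + t * (g1 x * u)).
have dF (s : R) : 0 <= s <= 1 -> is_derive s 1 F (r - (1 + s * r)^-1 * r).
  move=> s01; apply: is_deriveB; first exact: is_derive_affine.
  by apply: is_derive1_line; apply: is_derive1_ln; exact: den.
have dG (s : R) : 0 <= s <= 1 ->
    is_derive s 1 G (g1 (x + s * u) * u - g1 x * u).
  move=> s01; apply: is_deriveB; last exact: is_derive_affine.
  by apply: is_derive1_line; have [] := sc _ (pos _ s01).
have := increment_le_of_derive_le F G _ _ dF dG.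
rewrite /F /G !fctE !mul1r !mul0r !addr0 !add0r ln1 oppr0 !subr0 addr0 => H.
suff : r - ln (1 + r) <= g (x + u) - g1 x * u - g x by lra.
apply: H => s s01.
have /andP[+ _] := s01; rewrite le_eqVlt => /predU1P[<-|s0].
  by rewrite !mul0r !addr0 invr1 mul1r !subrr.
have := sc_derive_gap_ge x (s * u) x0 (pos _ s01).
rewrite normrM (gtr0_norm s0) mulrCA -/r -mulrBl => H.
rewrite -(ler_pM2l s0) [leRHS](_ : _ = s * u * (g1 (x + s * u) - g1 x)); last by ring.
apply: le_trans H.
by rewrite le_eqVlt; apply/predU1P; left; field; rewrite gt_eqF// den.
Qed.

End Jet.

(** * Separable objectives *)

Lemma cauchy_schwarz_sum {R : rcfType} {n : nat} (a b : 'I_n -> R) :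
  \sum_i a i * b i <=
    Num.sqrt (\sum_i a i ^+ 2) * Num.sqrt (\sum_i b i ^+ 2).
Proof.
set P := \sum_i a i ^+ 2; set Q := \sum_i b i ^+ 2; set c := \sum_i _.
have P0 : 0 <= P by apply: sumr_ge0 => i _; exact: sqr_ge0.
have Q0 : 0 <= Q by apply: sumr_ge0 => i _; exact: sqr_ge0.
have [Q0'|Qn0] := eqVneq Q 0.
  rewrite Q0' sqrtr0 mulr0 /c big1// => i _.
  have /eqP : Q = 0 := Q0'.
  rewrite psumr_eq0; last by move=> j _; exact: sqr_ge0.
  by move=> /allP/(_ i (mem_index_enum _)) /=; rewrite sqrf_eq0 => /eqP ->; rewrite mulr0.
have Qgt0 : 0 < Q by rewrite lt_def Qn0.
have E : \sum_i (Q * a i - c * b i) ^+ 2 = Q * (Q * P - c ^+ 2).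
  under eq_bigr => i _.
    have -> : (Q * a i - c * b i) ^+ 2 =
      Q ^+ 2 * a i ^+ 2 - 2 * Q * c * (a i * b i) + c ^+ 2 * b i ^+ 2 by ring.
    over.
  by rewrite big_split/= sumrB -!mulr_sumr -/P -/Q -/c; ring.
have : 0 <= Q * P - c ^+ 2.
  by rewrite -(pmulr_rge0 _ Qgt0) -E; apply: sumr_ge0 => i _; exact: sqr_ge0.
rewrite subr_ge0 mulrC -sqrtrM// => H.
by rewrite (le_trans (ler_norm _))// -sqrtr_sqr ler_wsqrtr.
Qed.

Lemma minkowski_sum {R : rcfType} {n : nat} (a b : 'I_n -> R) :
  Num.sqrt (\sum_i (a i + b i) ^+ 2) <=
    Num.sqrt (\sum_i a i ^+ 2) + Num.sqrt (\sum_i b i ^+ 2).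
Proof.
have P0 : 0 <= \sum_i a i ^+ 2 by apply: sumr_ge0 => i _; exact: sqr_ge0.
have Q0 : 0 <= \sum_i b i ^+ 2 by apply: sumr_ge0 => i _; exact: sqr_ge0.
have H := cauchy_schwarz_sum a b.
rewrite -[leRHS]ger0_norm ?addr_ge0 ?sqrtr_ge0// -sqrtr_sqr ler_wsqrtr//.
rewrite sqrrD !sqr_sqrtr//.
under eq_bigr do rewrite sqrrD.
by rewrite !big_split/= lerD2r lerD2l mulr2n lerD.
Qed.

Lemma quad_diag_mx {R : realType} {n : nat} (w : 'rV[R]_n) (u : 'cV[R]_n) :
  quad (diag_mx w) u = \sum_i w 0 i * u i 0 ^+ 2.
Proof.
rewrite /quad -mulmxA mul_diag_mx mxE; apply: eq_bigr => i _.
by rewrite !mxE; ring.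
Qed.

(** No regularity of [h] is assumed: the difference quotient is literally the one-dimensional one,
    or identically zero. *)
Lemma derive_delta_coord {R : realType} {n : nat} (h : R -> R) (i j : 'I_n)
    (x : 'cV[R]_n) :
  'D_(delta_mx i 0) (fun y : 'cV[R]_n => h (y j 0)) x =
    if i == j then derive1 h (x j 0) else 0.
Proof.
rewrite /derive /derive1; case: eqVneq => [<-|ij].
  set d := (fun _ : R => _); set d' := (fun _ : R => _).
  suff -> : d = d' by []; apply/funext => t; rewrite /d /d' /=.
  by rewrite !mxE !eqxx mulr1.
under eq_fun do rewrite /= !mxE eq_sym (negbTE ij) mulr0 add0r subrr scaler0.
exact: lim_cst.
Qed.

(** The norm induced by a diagonal Hessian with entries [g2 i (x i 0)], written as a root of a sum
    of squares so that Cauchy-Schwarz and Minkowski apply directly. *)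
Definition local_norm {R : realType} {n : nat} (g2 : 'I_n -> R -> R)
    (x u : 'cV[R]_n) : R :=
  Num.sqrt (\sum_i (Num.sqrt (g2 i (x i 0)) * u i 0) ^+ 2).

Section Separable.
Context {R : realType} {n : nat}.
Variables (g : 'I_n -> R -> R).
Implicit Types (x u z dx dy : 'cV[R]_n).
Let F (x : 'cV[R]_n) := \sum_i g i (x i 0).

Lemma derive_separable (i : 'I_n) (x : 'cV[R]_n) :
  'D_(delta_mx i 0) F x = derive1 (g i) (x i 0).
Proof.
rewrite /derive /derive1; set d := (fun _ : R => _); set d' := (fun _ : R => _).
suff -> : d = d' by []; apply/funext => t; rewrite /d /d' /=.
rewrite /F -sumrB (bigD1 i)//= big1 ?addr0 => [|j ji].
  by rewrite !mxE !eqxx mulr1.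
by rewrite !mxE (negbTE ji) mulr0 add0r subrr.
Qed.

Variables (g1 g2 g3 : 'I_n -> R -> R).
Hypothesis sc : forall i, self_concordant_jet (g i) (g1 i) (g2 i) (g3 i).

Lemma grad_separable x i : positive_cV x -> grad F x i 0 = g1 i (x i 0).
Proof.
move=> x0; rewrite /grad mxE derive_separable derive1E.
by have [d1 _ _ _ _] := sc i _ (x0 i); rewrite derive_val.
Qed.

Lemma hessian_separable x : positive_cV x ->
  hessian F x = diag_mx (\row_i g2 i (x i 0)).
Proof.
move=> x0; apply/matrixP => i j; rewrite !mxE.
under eq_fun do rewrite derive_separable.
rewrite derive_delta_coord eq_sym; case: eqVneq => [->|_]; last by rewrite mulr0n.
rewrite mulr1n derive1E.
have [_ d2 _ _ _] := sc i _ (x0 i).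
(* The first derivative agrees with [g1] only at positive points; a neighbourhood of [x i 0] is
   enough to differentiate again. *)
rewrite -(@derive_val _ _ _ _ _ _ _ d2); apply: near_eq_derive.
near=> t; have t0 : 0 < t by near: t; exact: lt_nbhsr.
by have [d1 _ _ _ _] := sc i _ t0; rewrite derive1E derive_val.
Unshelve. all: by end_near. Qed.

Lemma quad_hessian_separable x u : positive_cV x ->
  quad (hessian F x) u = \sum_i (Num.sqrt (g2 i (x i 0)) * u i 0) ^+ 2.
Proof.
move=> x0; rewrite hessian_separable// quad_diag_mx; apply: eq_bigr => i _.
by rewrite mxE exprMn (sc_sqrt_sqr _ _ _ _ (sc i)).
Qed.

Lemma decrement_separable x u : positive_cV x -> decrement F x u = local_norm g2 x u.
Proof. by move=> x0; rewrite /decrement quad_hessian_separable. Qed.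

Lemma local_norm_triangle x u z :
  local_norm g2 x (u + z) <= local_norm g2 x u + local_norm g2 x z.
Proof.
rewrite /local_norm; apply: le_trans (minkowski_sum _ _).
rewrite ler_wsqrtr// le_eqVlt; apply/predU1P; left.
by apply: eq_bigr => i _; rewrite mxE mulrDr.
Qed.

Lemma local_normN x u : local_norm g2 x (- u) = local_norm g2 x u.
Proof.
by congr Num.sqrt; apply: eq_bigr => i _; rewrite mxE mulrN sqrrN.
Qed.

Lemma coord_le_local_norm x u i :
  Num.sqrt (g2 i (x i 0)) * `|u i 0| <= local_norm g2 x u.
Proof.
rewrite -[X in X * _]ger0_norm ?sqrtr_ge0// -normrM -sqrtr_sqr ler_wsqrtr//.
by rewrite (bigD1 i)//= lerDl; apply: sumr_ge0 => j _; exact: sqr_ge0.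
Qed.

Lemma local_norm_abs x u :
  \sum_i (Num.sqrt (g2 i (x i 0)) * `|u i 0|) ^+ 2 = local_norm g2 x u ^+ 2.
Proof.
rewrite sqr_sqrtr; last by apply: sumr_ge0 => i _; exact: sqr_ge0.
by apply: eq_bigr => i _; rewrite !exprMn real_normK ?num_real.
Qed.

Variables (m : nat) (A : 'M[R]_(m, n)).

(** Pairing the Newton equation with a vector of the kernel of [A] removes the dual variable. *)
Lemma newton_dot x dx u : positive_cV x ->
  (exists w : 'cV[R]_m, hessian F x *m dx + A^T *m w = - grad F x) ->
  A *m u = 0 ->
  \sum_i g1 i (x i 0) * u i 0 = - \sum_i g2 i (x i 0) * dx i 0 * u i 0.
Proof.
move=> x0 [w E] Au.
have gradE : (u^T *m grad F x) 0 0 = \sum_i g1 i (x i 0) * u i 0.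
  rewrite mxE; apply: eq_bigr => i _.
  by rewrite grad_separable// mxE mulrC.
have hessE : (u^T *m (hessian F x *m dx)) 0 0 =
    \sum_i g2 i (x i 0) * dx i 0 * u i 0.
  rewrite hessian_separable// mul_diag_mx mxE; apply: eq_bigr => i _.
  by rewrite !mxE; ring.
rewrite -gradE -hessE; have := congr1 (mulmx u^T) E.
rewrite mulmxDr [u^T *m (A^T *m w)]mulmxA -trmx_mul Au trmx0 mul0mx addr0.
by rewrite mulmxN => ->; rewrite [in RHS]mxE opprK.
Qed.

(* The Newton equation at [x + dy] tested against [z], minus the one at [x],
   leaves the direction error and the second-order remainder. *)
Lemma inexact_newton_step x dx dy z (lt := local_norm g2 x dy) :
  positive_cV x -> positive_cV (x + dy) ->
  (exists w : 'cV[R]_m, hessian F x *m dx + A^T *m w = - grad F x) ->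
  (exists w : 'cV[R]_m,
     hessian F (x + dy) *m z + A^T *m w = - grad F (x + dy)) ->
  A *m z = 0 -> lt < 1 ->
  local_norm g2 (x + dy) z * (1 - lt) <=
    local_norm g2 x (dx - dy) + lt ^+ 2 / (1 - lt).
Proof.
move=> x0 y0 nx ny Az lt1.
have lt0 : 0 <= lt by rewrite sqrtr_ge0.
pose s (i : 'I_n) : R := Num.sqrt (g2 i (x i 0)).
have xy0 i : 0 < x i 0 + dy i 0 by have := y0 i; rewrite mxE.
have r_lt i : s i * `|dy i 0| <= lt by exact: coord_le_local_norm.
set B := local_norm g2 x (dx - dy) + lt ^+ 2 / (1 - lt).
have B0 : 0 <= B by rewrite addr_ge0 ?sqrtr_ge0// divr_ge0 ?exprn_ge0// subr_ge0 ltW.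
(* The squared norm at the new point is bounded by [B] times the norm of [z] at the old point; [zle]
   below converts the latter back at the price of a factor [1 - lt]. *)
have zz : local_norm g2 (x + dy) z ^+ 2 <= B * local_norm g2 x z.
  have -> : local_norm g2 (x + dy) z ^+ 2 =
      \sum_i g2 i (x i 0) * (dx i 0 - dy i 0) * z i 0
    + \sum_i - (g1 i (x i 0 + dy i 0) - g1 i (x i 0) - g2 i (x i 0) * dy i 0)
              * z i 0.
    transitivity (\sum_i g2 i ((x + dy) i 0) * z i 0 * z i 0).
      rewrite sqr_sqrtr; last by apply: sumr_ge0 => i _; exact: sqr_ge0.
      apply: eq_bigr => i _.
      by rewrite exprMn (sc_sqrt_sqr _ _ _ _ (sc i)) ?mulrA.
    have := newton_dot _ _ _ y0 ny Az; have := newton_dot _ _ _ x0 nx Az.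
    move=> Ex /esym/(congr1 -%R); rewrite opprK => ->.
    rewrite -big_split/= -sumrN.
    have -> : \sum_i - (g1 i ((x + dy) i 0) * z i 0) =
       \sum_i - (g1 i ((x + dy) i 0) * z i 0) + (\sum_i g1 i (x i 0) * z i 0
          + \sum_i g2 i (x i 0) * dx i 0 * z i 0).
      by rewrite Ex addNr addr0.
    rewrite -!big_split/=; apply: eq_bigr => i _; rewrite !mxE; ring.
  rewrite /B mulrDl; apply: lerD.
    apply: le_trans (cauchy_schwarz_sum _ _).
    rewrite le_eqVlt; apply/predU1P; left.
    apply: eq_bigr => i _; rewrite !mxE -[in LHS](sc_sqrt_sqr _ _ _ _ (sc i))//.
    ring.
  apply: (@le_trans _ _ (\sum_i lt / (1 - lt) * ((s i * `|dy i 0|) * (s i * `|z i 0|)))).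
    apply: ler_sum => i _; apply: le_trans (ler_norm _) _.
    rewrite normrM normrN.
    (* The one-dimensional remainder estimate; since [r / (1 - r)] increases in [r], it may be
       replaced by its value at [lt], leaving a sum for Cauchy-Schwarz. *)
    apply: (@le_trans _ _ (s i * ((s i * `|dy i 0|) ^+ 2 / (1 - s i * `|dy i 0|)) * `|z i 0|)).
      rewrite ler_wpM2r//; apply: (sc_newton_remainder _ _ _ _ (sc i)) => //.
      exact: le_lt_trans (r_lt i) lt1.
    have := r_lt i; have : 0 <= s i * `|dy i 0| by rewrite mulr_ge0// sqrtr_ge0.
    set r := s i * `|dy i 0| => r0 rlt.
    have -> : s i * (r ^+ 2 / (1 - r)) * `|z i 0| = (r / (1 - r)) * (r * (s i * `|z i 0|)).
      by move: (1 - r)^-1 => q; ring.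
    rewrite ler_wpM2r//.
      by rewrite !mulr_ge0// sqrtr_ge0.
    rewrite ler_pdivrMr ?subr_gt0 ?(le_lt_trans rlt)//.
    rewrite mulrAC ler_pdivlMr ?subr_gt0//.
    nra.
  rewrite -mulr_sumr.
  have -> : lt ^+ 2 / (1 - lt) * local_norm g2 x z =
      lt / (1 - lt) * (lt * local_norm g2 x z).
    by move: (1 - lt)^-1 => q; ring.
  rewrite ler_wpM2l//.
    by rewrite divr_ge0// subr_ge0 ltW.
  apply: le_trans (cauchy_schwarz_sum _ _) _.
  by rewrite !local_norm_abs !sqrtr_sqr !ger0_norm ?sqrtr_ge0.
have zle : local_norm g2 x z * (1 - lt) <= local_norm g2 (x + dy) z.
  have l1 : 0 <= 1 - lt by rewrite subr_ge0 ltW.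
  rewrite -[X in _ * X]ger0_norm// -sqrtr_sqr -sqrtrM; last first.
    by apply: sumr_ge0 => i _; exact: sqr_ge0.
  rewrite ler_wsqrtr// mulr_suml; apply: ler_sum => i _.
  have := sc_sqrt_le _ _ _ _ (sc i) (x i 0) (dy i 0) (x0 i) (xy0 i).
  rewrite -/(s i) => H.
  rewrite [leLHS](_ : _ = (s i * (1 - lt)) ^+ 2 * z i 0 ^+ 2); last first.
    by rewrite /s; ring.
  rewrite mxE [leRHS]exprMn ler_wpM2r ?sqr_ge0// ler_pXn2r ?nnegrE ?sqrtr_ge0//.
    (* Combine [sc_sqrt_le] with [(1 + lt) (1 - lt) <= 1]. *)
    apply: (@le_trans _ _ (Num.sqrt (g2 i (x i 0 + dy i 0)) * (1 + lt) * (1 - lt))).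
      rewrite ler_wpM2r// (le_trans H)// ler_wpM2l ?sqrtr_ge0// lerD2l.
      exact: r_lt.
    by rewrite -mulrA ler_piMr ?sqrtr_ge0//; nra.
  by rewrite mulr_ge0// sqrtr_ge0.
have [->|ln0] := eqVneq (local_norm g2 (x + dy) z) 0; first by rewrite mul0r.
have lgt : 0 < local_norm g2 (x + dy) z by rewrite lt_def ln0 sqrtr_ge0.
rewrite -(ler_pM2l lgt) mulrA -expr2.
apply: (@le_trans _ _ (B * (local_norm g2 x z * (1 - lt)))).
  by rewrite mulrA ler_wpM2r// subr_ge0 ltW.
by rewrite mulrC ler_wpM2r.
Qed.

(** Sum [sc_lower_bound] over the coordinates. The Newton equation turns the linear term into minus
    the pairing of [dx] with [y - x]; in each coordinate [damping_tradeoff] absorbs that pairing at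
    cost [q^2], and these costs add up to the squared decrement. *)
Lemma suboptimality_le x y dx : positive_cV x -> positive_cV y ->
  A *m x = A *m y ->
  (exists w : 'cV[R]_m, hessian F x *m dx + A^T *m w = - grad F x) ->
  local_norm g2 x dx <= 1 / 2 ->
  F x - local_norm g2 x dx ^+ 2 <= F y.
Proof.
move=> x0 y0 Axy nx l2.
have Au : A *m (y - x) = 0 by rewrite mulmxBr Axy subrr.
have yE i : y i 0 = x i 0 + (y - x) i 0 by rewrite !mxE addrCA subrr addr0.
have := newton_dot _ _ _ x0 nx Au.
rewrite -local_norm_abs.
set u := y - x in Au yE *; clearbody u => Ex.
have H : \sum_i (g i (x i 0) + g1 i (x i 0) * u i 0 + g2 i (x i 0) * dx i 0 * u i 0
    - (Num.sqrt (g2 i (x i 0)) * `|dx i 0|) ^+ 2) <= F y.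
  apply: ler_sum => i _.
  have yi0 := y0 i; rewrite yE in yi0 *.
  apply: le_trans (sc_lower_bound _ _ _ _ (sc i) _ _ (x0 i) yi0).
  have q12 : 0 <= Num.sqrt (g2 i (x i 0)) * `|dx i 0| <= 1 / 2.
    by rewrite mulr_ge0 ?sqrtr_ge0//= (le_trans _ l2)// coord_le_local_norm.
  have r0 : 0 <= Num.sqrt (g2 i (x i 0)) * `|u i 0| by rewrite mulr_ge0 ?sqrtr_ge0.
  have := damping_tradeoff _ _ q12 r0.
  have -> : Num.sqrt (g2 i (x i 0)) * `|dx i 0| * (Num.sqrt (g2 i (x i 0)) * `|u i 0|)
     = `|g2 i (x i 0) * dx i 0 * u i 0|.
    rewrite !normrM -[in RHS](sc_sqrt_sqr _ _ _ _ (sc i))//.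
    by rewrite normrX ger0_norm ?sqrtr_ge0//; ring.
  have := ler_norm (g2 i (x i 0) * dx i 0 * u i 0).
  set a := g2 _ _ * _ * _; lra.
apply: le_trans H.
by rewrite sumrB !big_split/= Ex addrNK.
Qed.

End Separable.

(** * The scalar recursion *)

Section DecrementRecursion.
Context {R : realFieldType}.

(** Dividing by [1 - lt] leaves [(p + e) T + e + T^2] with [T = lt / (1 - lt)], and
    [T <= (a + e) / D]. The level [A] stays free because two different levels are used later. *)
Lemma inexact_decrement_bound (p e a A lt a' : R) :
  0 < p -> 0 < e -> 0 <= lt -> lt < 1 -> a <= A -> 0 < 1 - p - A - e ->
  lt * (1 - p) <= a + e ->
  a' * (1 - lt) <= p * lt + e + lt ^+ 2 / (1 - lt) ->
  a' <= (a + e) ^+ 2 / (1 - p - A - e) ^+ 2 + (p * a + e) / (1 - p - A - e).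
Proof.
move=> p0 e0 lt0 lt1 aA D0 H1 H2.
set D := 1 - p - A - e in D0 *.
pose T := lt / (1 - lt).
have l0 : 0 < 1 - lt by rewrite subr_gt0.
have T0 : 0 <= T by rewrite divr_ge0// ltW.
have TD : T <= (a + e) / D.
  rewrite ler_pdivrMr// mulrAC ler_pdivlMr//.
  by rewrite /D; nra.
have {}H2 : a' <= (p + e) * T + e + T ^+ 2.
  rewrite -(ler_pM2r l0) (le_trans H2)// le_eqVlt; apply/predU1P; left.
  by rewrite /T; field; rewrite gt_eqF.
apply: (le_trans H2); rewrite addrC; apply: lerD.
  by rewrite -expr_div_n ler_pXn2r ?nnegrE// (le_trans T0).
apply: (@le_trans _ _ ((p + e) * ((a + e) / D) + e)).
  by rewrite lerD2r ler_pM2l// addr_gt0.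
have -> : (p + e) * ((a + e) / D) + e = ((p + e) * (a + e) + e * D) / D.
  by field; rewrite gt_eqF.
rewrite ler_pM2r ?invr_gt0//.
by rewrite /D; nra.
Qed.

Variables (p e phi xi v delta : R).
Let D := 1 - p - phi - e.
Hypotheses (p0 : 0 < p) (e0 : 0 < e) (phi0 : 0 < phi) (D0 : 0 < D).
Hypothesis phi_D : 2 * phi <= D ^+ 2.
Hypothesis xiE : xi = (phi * p + e) / D + (2 * phi * e + e ^+ 2) / D ^+ 2.
Hypothesis vE : v = 1 / D ^+ 2.
Hypothesis rel2 : v * (68 / 100) ^+ 2 + xi <= 68 / 100.
Hypotheses (delta0 : 0 <= delta) (delta1 : delta < 1 / 2).
Hypothesis rel5 : xi + v * xi <= delta / (4 * v).

Let D1 : D < 1.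
Proof. by have := p0; have := e0; have := phi0; rewrite /D; lra. Qed.

Let vD : v * D ^+ 2 = 1.
Proof. by rewrite vE divfK// gt_eqF// exprn_gt0. Qed.

Let v1 : 1 <= v.
Proof. by rewrite vE div1r invf_ge1 ?exprn_gt0// expr_le1// ltW. Qed.

Let xi0 : 0 < xi.
Proof.
rewrite xiE addr_gt0// divr_gt0 ?exprn_gt0// addr_gt0 ?exprn_gt0//.
  by rewrite mulr_gt0.
by rewrite !mulr_gt0.
Qed.

Let rel5' : v * xi * (1 + v) <= delta / 4.
Proof.
have v0 : 0 < v by rewrite (lt_le_trans _ v1).
have -> : delta / 4 = delta / (4 * v) * v by field; rewrite gt_eqF.
have -> : v * xi * (1 + v) = (xi + v * xi) * v by ring.
by rewrite ler_pM2r.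
Qed.

(** With [v = D^-2], the smallness of [xi] reads [xi (1 + D^2) <= D^4 / 8]; then
    [1 + D^2 >= 2 D]. *)
Let xi_le : xi <= D ^+ 3 / 16.
Proof.
have : xi * (1 + D ^+ 2) <= D ^+ 4 / 8.
  have -> : xi * (1 + D ^+ 2) = v * xi * (1 + v) * D ^+ 4.
    transitivity (xi * (v * D ^+ 2) * (D ^+ 2 + v * D ^+ 2)); last by ring.
    by rewrite vD; ring.
  rewrite [leRHS]mulrC ler_pM2r ?exprn_gt0//; have := rel5'; have := delta1; lra.
move=> H.
have : 2 * D * xi <= 2 * D * (D ^+ 3 / 16).
  have -> : 2 * D * (D ^+ 3 / 16) = D ^+ 4 / 8 by field.
  apply: le_trans H; rewrite -subr_ge0.
  have -> : xi * (1 + D ^+ 2) - 2 * D * xi = xi * (1 - D) ^+ 2 by ring.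
  by rewrite mulr_ge0 ?sqr_ge0// ltW.
by rewrite ler_pM2l// mulr_gt0.
Qed.

Let xi_le16 : xi <= 1 / 16.
Proof.
by rewrite (le_trans xi_le)// ler_pM2r ?invr_gt0// exprn_ile1// ltW.
Qed.

(** The relation [rel2] forces [0.68 v <= 1], that is [D^2 >= 0.68], which exceeds [0.82^2]. *)
Let D_ge : 82 / 100 < D.
Proof.
have H : v * (68 / 100) ^+ 2 <= 68 / 100 by have := xi0; have := rel2; lra.
have : v * (68 / 100) ^+ 2 * D ^+ 2 <= 68 / 100 * D ^+ 2.
  by rewrite ler_pM2r// exprn_gt0.
rewrite mulrAC vD mul1r => H2.
rewrite ltNge; apply/negP => H3.
have : D ^+ 2 <= (82 / 100) ^+ 2 by rewrite ler_pXn2r ?nnegrE ?(ltW D0)//; lra.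
lra.
Qed.

Let F A a := (a + e) ^+ 2 / (1 - p - A - e) ^+ 2 + (p * a + e) / (1 - p - A - e).

(** The number [xi] collects all terms other than [v a^2], with [a] replaced by its upper bound
    [phi]. *)
Let F_phi a : 0 <= a -> a <= phi -> F phi a <= v * a ^+ 2 + xi.
Proof.
move=> a0 aphi; rewrite /F -/D.
have -> : (a + e) ^+ 2 / D ^+ 2 =
    v * a ^+ 2 + (2 * a * e + e ^+ 2) / D ^+ 2.
  by rewrite vE; field; rewrite gt_eqF.
rewrite -addrA lerD2l xiE addrC lerD//.
  by rewrite ler_pM2r ?invr_gt0// lerD2r mulrC ler_pM2r.
by rewrite ler_pM2r ?invr_gt0 ?exprn_gt0// lerD2r ler_pM2r// ler_pM2l.
Qed.

(* If the bound [F phi phi] exceeds [phi], then [phi < 2 xi] and the level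
   [3 xi] takes over the role of [phi] as an invariant upper bound. *)
Let D_3xi : 0 < 1 - p - 3 * xi - e.
Proof.
have : D ^+ 3 <= D by rewrite -[leRHS]expr1 ler_wiXn2l// ltW.
have := xi_le; have := D_ge; have := phi0; rewrite /D; lra.
Qed.

(** With [s = xi / D], the bounds [e <= D xi], [p <= 1 - D] and [1 - p - 3 xi - e >= D (1 - 3 s)]
    reduce the claim to a polynomial inequality in [s] and [D], into which [s <= D^2 / 16] is
    inserted. *)
Let F_3xi a : 0 <= a -> a <= 3 * xi -> F (3 * xi) a <= 3 * xi.
Proof.
move=> a0 a3.
have D30 := D_3xi.
pose s := xi / D.
have sD : xi = s * D by rewrite /s divfK// gt_eqF.
have s0 : 0 < s by rewrite divr_gt0.
have s16 : s <= D ^+ 2 / 16.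
  rewrite /s ler_pdivrMr//.
  by have -> : D ^+ 2 / 16 * D = D ^+ 3 / 16 by ring.
have s1 : 0 < 1 - 3 * s by have := D1; have := D_ge; nra.
have eD : e <= D * xi.
  rewrite mulrC -ler_pdivrMr// xiE.
  have : 0 <= (2 * phi * e + e ^+ 2) / D ^+ 2.
    by rewrite ltW// divr_gt0 ?exprn_gt0// addr_gt0 ?exprn_gt0// !mulr_gt0.
  have : 0 <= phi * p / D by rewrite ltW// divr_gt0// mulr_gt0.
  by rewrite [(phi * p + e) / D]mulrDl; lra.
have D3 : D * (1 - 3 * s) <= 1 - p - 3 * xi - e.
  by rewrite [xi]sD; have := phi0; rewrite /D; lra.
have DD0 : 0 < D * (1 - 3 * s) by rewrite mulr_gt0.
have pD : p <= 1 - D by have := phi0; have := e0; rewrite /D; lra.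
have T1 : (a + e) / (1 - p - 3 * xi - e) <= s * (3 + D) / (1 - 3 * s).
  rewrite ler_pdivrMr// mulrAC ler_pdivlMr//.
  apply: (@le_trans _ _ ((3 + D) * xi * (1 - 3 * s))).
    by rewrite ler_pM2r//; lra.
  have -> : (3 + D) * xi * (1 - 3 * s) = s * (3 + D) * (D * (1 - 3 * s)).
    by rewrite [xi]sD; ring.
  by rewrite ler_pM2l// mulr_gt0// addr_gt0.
have T2 : (p * a + e) / (1 - p - 3 * xi - e) <= s * (3 - 2 * D) / (1 - 3 * s).
  rewrite ler_pdivrMr// mulrAC ler_pdivlMr//.
  apply: (@le_trans _ _ ((3 - 2 * D) * xi * (1 - 3 * s))).
    have : p * a <= (1 - D) * (3 * xi) by rewrite ler_pM// ltW.
    by rewrite ler_pM2r//; lra.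
  have -> : (3 - 2 * D) * xi * (1 - 3 * s) = s * (3 - 2 * D) * (D * (1 - 3 * s)).
    by rewrite [xi]sD; ring.
  by rewrite ler_pM2l// mulr_gt0//; have := D1; lra.
rewrite /F -expr_div_n.
apply: (@le_trans _ _ ((s * (3 + D) / (1 - 3 * s)) ^+ 2 +
                       s * (3 - 2 * D) / (1 - 3 * s))).
  apply: lerD => //.
  have h0 : 0 <= (a + e) / (1 - p - 3 * xi - e).
    by rewrite divr_ge0// ltW// ltr_wpDl.
  by rewrite ler_pXn2r ?nnegrE// (le_trans h0).
have -> : (s * (3 + D) / (1 - 3 * s)) ^+ 2 + s * (3 - 2 * D) / (1 - 3 * s) =
    s * (s * (3 + D) ^+ 2 + (3 - 2 * D) * (1 - 3 * s)) / (1 - 3 * s) ^+ 2.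
  by field; rewrite gt_eqF.
rewrite ler_pdivrMr ?exprn_gt0// [xi]sD.
have -> : 3 * (s * D) * (1 - 3 * s) ^+ 2 = s * (3 * D * (1 - 3 * s) ^+ 2) by ring.
rewrite ler_pM2l//.
have := D_ge; have := D1; have := D0.
move: (D) s s0 s16 s1 {sD T1 T2 eD D3 DD0 pD} => E s s0 s16 s1 E0 E1 Ege.
have K1 : s * ((3 + E) ^+ 2 - 9 + 6 * E) <= E ^+ 2 / 16 * ((3 + E) ^+ 2 - 9 + 6 * E).
  by rewrite ler_wpM2r//; nra.
have K2 : 1 - 6 * (E ^+ 2 / 16) <= (1 - 3 * s) ^+ 2 by nra.
have K3 : 3 * E * (1 - 6 * (E ^+ 2 / 16)) <= 3 * E * (1 - 3 * s) ^+ 2.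
  by rewrite ler_wpM2l// mulr_ge0// ltW.
apply: le_trans K3.
have -> : s * (3 + E) ^+ 2 + (3 - 2 * E) * (1 - 3 * s) =
  s * ((3 + E) ^+ 2 - 9 + 6 * E) + (3 - 2 * E) by ring.
have {}K1 : s * ((3 + E) ^+ 2 - 9 + 6 * E) + (3 - 2 * E) <=
  E ^+ 2 / 16 * ((3 + E) ^+ 2 - 9 + 6 * E) + (3 - 2 * E) by rewrite lerD2r.
apply: le_trans K1 _.
have E43 : E ^+ 4 <= E ^+ 3 by rewrite ler_wiXn2l// ltW.
(* The cubic is concave for [E > 0] and positive at 0.82 and at 1, hence on the whole range of
   [E]. *)
have : 0 <= -3 + 5 * E - 31 / 16 * E ^+ 3.
  by nra.
nra.
Qed.

Let vphi : v * phi <= 1 / 2.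
Proof.
have : v * (2 * phi) <= v * D ^+ 2.
  by rewrite ler_wpM2l// (le_trans _ v1).
by rewrite vD; lra.
Qed.

(** Here [q] stands for [2^-(2^m)]: the claimed bound is affine in [q], and passing from [m] to
    [m + 1] squares [q]. This is the induction step. *)
Let bound_step q : 0 <= q -> q <= 1 / 4 ->
  v * (q / v + xi + delta / v * (1 / 2 - q)) ^+ 2 + xi <=
  q ^+ 2 / v + xi + delta / v * (1 / 2 - q ^+ 2).
Proof.
move=> q0 q1.
have v0 : 0 < v by rewrite (lt_le_trans _ v1).
pose y := v * xi.
have y0 : 0 <= y by rewrite mulr_ge0// ltW.
have y8 : y <= delta / 8 by have := rel5'; have := v1; rewrite -/y; nra.
have -> : v * (q / v + xi + delta / v * (1 / 2 - q)) ^+ 2 =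
    (q + y + delta * (1 / 2 - q)) ^+ 2 / v.
  by rewrite /y; field; rewrite gt_eqF.
have -> : q ^+ 2 / v + xi + delta / v * (1 / 2 - q ^+ 2) =
    (q ^+ 2 + delta * (1 / 2 - q ^+ 2)) / v + xi.
  by field; rewrite gt_eqF.
rewrite lerD2r ler_pM2r ?invr_gt0//.
move: (y) y0 y8 delta0 delta1 => z z0 z8 d0 d1.
(* Since [z <= delta / 8], the base of the square is at most [q (1 - delta) + 5/8 delta]; the
   remaining difference has [delta] as a factor. *)
have w0 : 0 <= q + z + delta * (1 / 2 - q).
  by rewrite !addr_ge0// mulr_ge0// subr_ge0; lra.
apply: (@le_trans _ _ ((q * (1 - delta) + 5 / 8 * delta) ^+ 2)).
  by rewrite ler_pXn2r ?nnegrE//; [lra|nra].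
rewrite -subr_ge0.
have -> : q ^+ 2 + delta * (1 / 2 - q ^+ 2) - (q * (1 - delta) + 5 / 8 * delta) ^+ 2
  = delta * (q ^+ 2 * (1 - delta) + 1 / 2 - 5 / 4 * q * (1 - delta) - 25 / 64 * delta).
  by field.
rewrite mulr_ge0//.
by nra.
Qed.

Let dyadicE m : (1 <= m)%N ->
  1 / (2 ^+ (2 ^ m)%N * v) + xi
    + delta / v * ((2 ^+ (2 ^ m - 1)%N - 1) / 2 ^+ (2 ^ m)%N) =
  (2 ^- (2 ^ m)%N) / v + xi + delta / v * (1 / 2 - 2 ^- (2 ^ m)%N).
Proof.
move=> m1.
have v0 : v != 0 by rewrite gt_eqF// (lt_le_trans _ v1).
have -> : 2 ^+ (2 ^ m)%N = 2 * 2 ^+ (2 ^ m - 1)%N :> R.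
  by rewrite -exprS subn1 prednK// expn_gt0.
have : 2 ^+ (2 ^ m - 1)%N != 0 :> R by rewrite expf_neq0// pnatr_eq0.
by move: (2 ^+ (2 ^ m - 1)%N) => t t0; field; rewrite t0 v0.
Qed.

Let dyadic_le m : (1 <= m)%N -> 2 ^- (2 ^ m)%N <= 1 / 4 :> R.
Proof.
move=> m1; rewrite div1r lef_pV2 ?posrE ?exprn_gt0//.
have -> : 4 = 2 ^+ 2 :> R by ring.
by rewrite ler_weXn2l ?ler1n// (@leq_pexp2l 2 1 m).
Qed.

(** The parts without [xi] add up to at most 3/8, reached at [q = 1/4], [delta = 1/2], [v = 1], and
    [xi <= 1/16]. This brings the iterates into the range of [suboptimality_le]. *)
Lemma decrement_bound_le_half m : (1 <= m)%N ->
  1 / (2 ^+ (2 ^ m)%N * v) + xi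
    + delta / v * ((2 ^+ (2 ^ m - 1)%N - 1) / 2 ^+ (2 ^ m)%N) <= 1 / 2.
Proof.
move=> m1; rewrite dyadicE//.
have v0 : 0 < v by rewrite (lt_le_trans _ v1).
have := dyadic_le m m1; have : 0 < 2 ^- (2 ^ m)%N :> R by rewrite invr_gt0 exprn_gt0.
move: (2 ^- _) => q q0 q4.
have : (q + delta * (1 / 2 - q)) / v <= q + delta * (1 / 2 - q).
  have w0 : 0 <= q + delta * (1 / 2 - q).
    by rewrite addr_ge0 ?(ltW q0)// mulr_ge0// subr_ge0; lra.
  by rewrite ler_pdivrMr// ler_peMr.
have -> : q / v + xi + delta / v * (1 / 2 - q) = (q + delta * (1 / 2 - q)) / v + xi.
  by field; rewrite gt_eqF.
have := xi_le16; have := delta0; have := delta1; nra.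
Qed.

Lemma decrement_bound_le_limit m : (1 <= m)%N ->
  1 / (2 ^+ (2 ^ m)%N * v) + xi
    + delta / v * ((2 ^+ (2 ^ m - 1)%N - 1) / 2 ^+ (2 ^ m)%N) <=
  xi + delta / (2 * v) + 2 ^- (2 ^ m)%N.
Proof.
move=> m1; rewrite dyadicE//.
have v0 : 0 < v by rewrite (lt_le_trans _ v1).
have : 0 < 2 ^- (2 ^ m)%N :> R by rewrite invr_gt0 exprn_gt0.
move: (2 ^- _) => q q0.
have qv : q / v <= q by rewrite ler_pdivrMr// ler_peMr// ltW.
have dq : 0 <= delta / v * q by rewrite mulr_ge0 ?(ltW q0)// divr_ge0// ltW.
have -> : q / v + xi + delta / v * (1 / 2 - q) =
    xi + delta / (2 * v) + q / v - delta / v * q.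
  by field; rewrite gt_eqF.
by rewrite lerBlDr -[leRHS]addrA lerD2l ler_wpDr.
Qed.

Lemma decrement_sequence_bound (a : nat -> R) :
  (forall m, 0 <= a m) -> a 0%N <= phi ->
  (forall m A, a m <= A -> 0 < 1 - p - A - e ->
     a m.+1 <= (a m + e) ^+ 2 / (1 - p - A - e) ^+ 2
               + (p * a m + e) / (1 - p - A - e)) ->
  forall m, (1 <= m)%N ->
    a m <= 1 / (2 ^+ (2 ^ m)%N * v) + xi
           + delta / v * ((2 ^+ (2 ^ m - 1)%N - 1) / 2 ^+ (2 ^ m)%N).
Proof.
move=> a0 aphi astep m m1; rewrite dyadicE//.
have v0 : 0 < v by rewrite (lt_le_trans _ v1).
have vphi2 : v * phi ^+ 2 <= phi / 2.
  by rewrite expr2 mulrA [phi / 2]mulrC ler_pM2r// -div1r.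
have [good|bad] := leP (v * phi ^+ 2 + xi) phi; last first.
  (* Here [phi < v phi^2 + xi <= phi / 2 + xi]. *)
  have phi2 : phi <= 3 * xi by have := xi0; have := phi0; lra.
  have {}a3 k : a k <= 3 * xi.
    elim: k => [|k IH]; first exact: le_trans aphi phi2.
    by apply: (le_trans (astep _ _ IH D_3xi)); exact: F_3xi.
  apply: (le_trans (a3 m)).
  have := dyadic_le m m1; have : 0 < 2 ^- (2 ^ m)%N :> R by rewrite invr_gt0 exprn_gt0.
  move: (2 ^- _) => q q0 q4.
  (* The first term is at least [2 (xi + v xi) >= 4 xi] by [rel5]. *)
  have -> : q / v + xi + delta / v * (1 / 2 - q) =
      (delta / (4 * v)) * 2 + q * (1 - delta) / v + xi.
    by field; rewrite gt_eqF.
  have : 0 <= q * (1 - delta) / v.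
    by rewrite divr_ge0 ?(ltW v0)// mulr_ge0 ?(ltW q0)// subr_ge0; have := delta1; lra.
  have : xi <= v * xi by rewrite ler_peMl// ltW.
  have := rel5; have := xi0; lra.
have aphi' k : a k <= phi.
  elim: k => [//|k IH].
  apply: (le_trans (astep _ _ IH D0)); apply: (le_trans (F_phi _ (a0 k) IH)).
  apply: le_trans good; rewrite lerD2r ler_pM2l//.
  by rewrite ler_pXn2r ?nnegrE// ltW.
have arec k : a k.+1 <= v * a k ^+ 2 + xi.
  by apply: (le_trans (astep _ _ (aphi' k) D0)); exact: F_phi.
elim: m m1 => // -[_ _|m IH _].
  rewrite expn1; apply: (le_trans (arec 0%N)).
  (* Base case [m = 1]: [v phi <= 1/2] gives [(v a_0)^2 <= 1/4]. *)
  have h : v * a 0%N ^+ 2 <= 2 ^- 2 / v.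
    rewrite ler_pdivlMr//.
    have -> : v * a 0%N ^+ 2 * v = (v * a 0%N) ^+ 2 by ring.
    have -> : 2 ^- 2 = (1 / 2) ^+ 2 :> R by field.
    rewrite ler_pXn2r ?nnegrE ?mulr_ge0 ?(ltW v0) ?invr_ge0 ?ler0n//.
    by apply: le_trans vphi; rewrite ler_pM2l.
  rewrite -[leLHS]addr0; apply: lerD; first by rewrite lerD2r.
  rewrite mulr_ge0 ?divr_ge0// ?(ltW v0)//.
  by rewrite subr_ge0; lra.
have {}IH := IH isT.
apply: (le_trans (arec m.+1)).
have q0 : 0 <= 2 ^- (2 ^ m.+1)%N :> R by rewrite invr_ge0 exprn_ge0.
have -> : 2 ^- (2 ^ m.+2)%N = (2 ^- (2 ^ m.+1)%N) ^+ 2 :> R.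
  by rewrite -!exprVn -exprM -expnSr.
apply: le_trans (bound_step _ q0 (dyadic_le m.+1 isT)).
rewrite lerD2r ler_pM2l// ler_pXn2r ?nnegrE//.
exact: le_trans (a0 _) IH.
Qed.

End DecrementRecursion.

(** * Utilities with a logarithmic barrier *)

Section Barrier.
Context {R : realType}.

Lemma MVT_gt0 (f df : R -> R) (a b : R) :
  (forall t : R, 0 < t -> is_derive t 1 f (df t)) -> 0 < a -> a < b ->
  exists c, [/\ a < c, c < b & f b - f a = df c * (b - a)].
Proof.
move=> fdf a0 ab.
have dab (t : R) : a <= t -> is_derive t 1 f (df t).
  by move=> leat; apply: fdf; exact: lt_le_trans leat.
have [||c] := @MVT R f df a b ab.
- by move=> t; rewrite in_itv/= => /andP[/ltW + _]; exact: dab.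
- apply: derivable_within_continuous => t; rewrite in_itv/= => /andP[/dab d _].
  exact: ex_derive.
- by rewrite in_itv/= => /andP[ac cb] E; exists c.
Qed.

(** If [h2 x < 0], then [h2] is negative within distance [e] of [x]. With [k = e / 3], the points
    [x], [x + k], [x + 2 k] stay in that range, and three mean values make the second increment of
    [h] smaller than the first, against midpoint convexity. *)
Lemma midpoint_convex_derive2_ge0 (h h1 h2 : R -> R) :
  (forall t : R, 0 < t -> is_derive t 1 h (h1 t)) ->
  (forall t : R, 0 < t -> is_derive t 1 h1 (h2 t)) ->
  (forall x y, 0 < x -> 0 < y -> h ((x + y) / 2) <= (h x + h y) / 2) ->
  forall x, 0 < x -> {for x, continuous h2} -> 0 <= h2 x.
Proof.
move=> dh dh1 cvx x x0 ch2; rewrite leNgt; apply/negP => neg.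
have /nbhs_ballP[e /= e0 eP] : \forall t \near x, h2 t < 0.
  exact: (@cvgr_lt _ _ _ _ h2 _ ch2 0 neg).
pose k := e / 3; have k0 : 0 < k by rewrite divr_gt0.
have xk : x < x + k by rewrite ltrDl.
have xk2 : x + k < x + k + k by rewrite ltrDl.
have xk0 : 0 < x + k by rewrite addr_gt0.
have [c [xc ck E1]] := MVT_gt0 _ _ _ _ dh x0 xk.
have [c' [kc ck' E2]] := MVT_gt0 _ _ _ _ dh xk0 xk2.
have cc' : c < c' by exact: lt_trans kc.
have [s [cs sc' E3]] := MVT_gt0 _ _ _ _ dh1 (lt_trans x0 xc) cc'.
have hs : h2 s < 0.
  apply: eP; rewrite /ball/= ltr_norml.
  have : k * 3 = e by rewrite /k divfK.
  by move=> ke; apply/andP; split; lra.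
have : h1 c' < h1 c.
  by rewrite -subr_lt0 E3 pmulr_llt0// subr_gt0.
have := cvx x (x + k + k) x0 (lt_trans xk0 xk2).
have -> : (x + (x + k + k)) / 2 = x + k by field.
move=> H1 H2.
have : h1 c' * k < h1 c * k by rewrite ltr_pM2r.
have -> : h1 c' * k = h (x + k + k) - h (x + k) by rewrite E2; ring.
have -> : h1 c * k = h (x + k) - h x by rewrite E1; ring.
by lra.
Qed.

(** Self-concordance adds up because [a^(3/2) + b^(3/2) <= (a + b)^(3/2)]. The barrier satisfies it
    by [mu >= 1], in the form [1/t <= sqrt (mu / t^2)], and makes the second derivative strictly
    positive. *)
Lemma log_barrier_jet (h h1 h2 h3 : R -> R) (mu : R) : 1 <= mu ->
  (forall t : R, 0 < t -> [/\ is_derive t 1 h (h1 t), is_derive t 1 h1 (h2 t),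
     is_derive t 1 h2 (h3 t), 0 <= h2 t &
     `|h3 t| <= 2 * (h2 t * Num.sqrt (h2 t))]) ->
  self_concordant_jet (h - (fun t => mu * ln t)) (h1 - (fun t => mu * t^-1))
    (h2 + (fun t => mu * t ^- 2)) (h3 - (fun t => 2 * mu * t ^- 3)).
Proof.
move=> mu1 hj t t0; have [d1 d2 d3 h20 h3le] := hj t t0.
have mu0 : 0 < mu by rewrite (lt_le_trans _ mu1).
have tn0 : t != 0 by rewrite gt_eqF.
have b0 : 0 < mu * t ^- 2 by rewrite mulr_gt0// invr_gt0 exprn_gt0.
split.
- by apply: is_deriveB; apply: is_deriveZ; exact: is_derive1_ln.
- rewrite (_ : (_ + _) t = h2 t - mu *: (- t ^- 2 *: 1)); last first.
    by rewrite /GRing.scale/= fctE mulr1 mulrN opprK.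
  by apply: is_deriveB; apply: is_deriveZ; exact: (@is_deriveV _ id).
- rewrite (_ : (_ - _) t = h3 t + mu *: (- (t ^+ 2) ^- 2 *: (2 * t))); last first.
    by rewrite /GRing.scale/= !fctE; field.
  apply: is_deriveD; apply: is_deriveZ.
  apply: (@is_deriveV _ (fun x => x ^+ 2)); first by rewrite expf_neq0.
  split; first exact: exprn_derivable.
  by rewrite exp_derive expr1 scaler1.
- by rewrite !fctE ltr_wpDl.
- rewrite !fctE.
  have t1 : t^-1 <= Num.sqrt (mu * t ^- 2).
    rewrite -[leLHS]ger0_norm ?invr_ge0 ?(ltW t0)// -sqrtr_sqr ler_wsqrtr//.
    by rewrite exprVn ler_peMl// invr_ge0 exprn_ge0// ltW.
  apply: le_trans (ler_normB _ _) _.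
  have -> : `|2 * mu * t ^- 3| = 2 * (mu * t ^- 2 * t^-1).
    rewrite ger0_norm; first by field.
    by rewrite !mulr_ge0 ?invr_ge0 ?exprn_ge0// ltW.
  apply: (@le_trans _ _ (2 * (h2 t * Num.sqrt (h2 t)) +
                         2 * (mu * t ^- 2 * Num.sqrt (mu * t ^- 2)))).
    by rewrite lerD// ler_pM2l// ler_pM2l.
  rewrite -mulrDr ler_pM2l// mulrDl lerD//.
    by rewrite ler_wpM2l// ler_wsqrtr// lerDl ltW.
  by rewrite ler_pM2l// ler_wsqrtr// lerDr.
Qed.

(** Nonnegativity of the second derivative is drawn from strict concavity at midpoints; the real
    power 3/2 is split as [1 + 1/2], with the value 0 treated apart. *)
Lemma utility_jet (u : R -> R) : strictly_concave_on `]0, +oo[ u ->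
  self_concordant_on `]0, +oo[ (fun t => - u t) ->
  forall t : R, 0 < t -> let g := fun t => - u t in
  [/\ is_derive t 1 g (derive1n 1 g t), is_derive t 1 (derive1n 1 g) (derive1n 2 g t),
     is_derive t 1 (derive1n 2 g) (derive1n 3 g t), 0 <= derive1n 2 g t &
     `|derive1n 3 g t| <= 2 * (derive1n 2 g t * Num.sqrt (derive1n 2 g t))].
Proof.
move=> cu [cd _ sc].
have itv (t : R) : 0 < t -> `]0, +oo[%classic t by rewrite /= in_itv/= andbT.
set g := fun t => - u t.
have dg n (t : R) : (n < 3)%N -> 0 < t -> is_derive t 1 (derive1n n g) (derive1n n.+1 g t).
  move=> n3 t0; have [/(_ n n3) d _] := cd t (itv t t0).
  by rewrite derive1nS derive1E; exact/derivableP.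
move=> t t0 /=.
have g20 : 0 <= derive1n 2 g t.
  apply: (@midpoint_convex_derive2_ge0 g (derive1n 1 g) (derive1n 2 g) _ _ _ t t0).
  - by move=> s; exact: (dg 0%N).
  - by move=> s; exact: (dg 1%N).
  - move=> x y x0 y0; rewrite /g; have [->|xy] := eqVneq x y.
      rewrite (_ : (y + y) / 2 = y); last by field.
      lra.
    have := cu x y (1 / 2) (itv _ x0) (itv _ y0) xy.
    have -> : 1 / 2 * x + (1 - 1 / 2) * y = (x + y) / 2 by field.
    have h0 : 0 < 1 / 2 :> R by lra.
    have h1 : 1 / 2 < 1 :> R by lra.
    by move=> /(_ h0 h1); lra.
  - have [/(_ 2%N isT) d _] := cd t (itv t t0).
    exact/differentiable_continuous/derivable1_diffP.
split; [exact: (dg 0%N)|exact: (dg 1%N)|exact: (dg 2%N)|exact: g20|].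
have := sc t (itv t t0); rewrite -/g.
suff -> : derive1n 2 g t `^ (3 / 2) = derive1n 2 g t * Num.sqrt (derive1n 2 g t) by [].
move: g20; rewrite le_eqVlt => /predU1P[<-|g20].
  by rewrite mul0r powR0// gt_eqF.
have -> : 3 / 2 = 1 + 2^-1 :> R by field.
by rewrite powRD ?(gt_eqF g20) ?implybT// powRr1 ?powR12_sqrt// ltW.
Qed.

End Barrier.

(** * The network objective as a separable sum *)

Lemma derive1n_cst0 {R : realType} n :
  derive1n n (fun _ : R => 0 : R) = (fun=> 0).
Proof.
elim: n => [//|n IH]; rewrite derive1nS IH.
by apply/funext => t; exact: derive1_cst.
Qed.

Section Objective.
Context {R : realType} {L S : nat}.
Variables (U : 'I_S -> R -> R) (mu : R).

(** Extension by zero to the slack coordinates, so that one sum over [S + L] covers the whole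
    objective. *)
Definition neg_utility (i : 'I_(S + L)) : R -> R :=
  match fintype.split i with inl j => fun t => - U j t | inr _ => fun=> 0 end.

Lemma objective_separable :
  objective U mu =
  fun x : 'cV[R]_(S + L) => \sum_i (neg_utility i - (fun t => mu * ln t)) (x i 0).
Proof.
apply/funext => x; rewrite /objective [RHS]sumrB -mulr_sumr; congr (_ - _).
rewrite big_split_ord/= [X in _ = _ + X]big1 => [|i _]; last first.
  by rewrite /neg_utility -/(unsplit (inr i)) unsplitK.
rewrite addr0 -sumrN; apply: eq_bigr => i _.
by rewrite /neg_utility -/(unsplit (inl i)) unsplitK.
Qed.

Lemma objective_jet (i : 'I_(S + L)) : 1 <= mu ->
  (forall j, strictly_concave_on `]0, +oo[ (U j)) ->
  (forall j, self_concordant_on `]0, +oo[ (fun t => - U j t)) ->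
  self_concordant_jet (neg_utility i - (fun t => mu * ln t))
    (derive1n 1 (neg_utility i) - (fun t => mu * t^-1))
    (derive1n 2 (neg_utility i) + (fun t => mu * t ^- 2))
    (derive1n 3 (neg_utility i) - (fun t => 2 * mu * t ^- 3)).
Proof.
move=> mu1 cU scU; apply: log_barrier_jet; first exact: mu1.
move=> t t0.
rewrite /neg_utility; case: (fintype.split i) => [j|j]; first exact: utility_jet.
rewrite !derive1n_cst0; split.
- exact: is_derive_cst.
- exact: is_derive_cst.
- exact: is_derive_cst.
- by [].
- by rewrite normr0 mul0r mulr0.
Qed.

End Objective.

(** * Tail estimates for the upper limit *)

Lemma limn_esup_le_tail {R : realType} (u : nat -> \bar R) (l : \bar R)
    (M : nat) :
  (forall m, (M <= m)%N -> (u m <= l)%E) -> (limn_esup u <= l)%E.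
Proof.
move=> ul; apply: (@le_trans _ _ (ereal_sup (u @` [set m | (M <= m)%N]))).
  by apply: ereal_inf_lbound; exists [set m | (M <= m)%N] => //=; exists M.
by apply: ge_ereal_sup => _ [m /= Mm <-]; exact: ul.
Qed.

Lemma inv_double_exp_small {R : realType} (eta : R) : 0 < eta ->
  exists M : nat, (1 <= M)%N /\ forall m, (M <= m)%N -> 2 ^- (2 ^ m)%N <= eta.
Proof.
move=> eta0; pose M := (Num.bound eta^-1).+1; exists M; split => // m Mm.
rewrite -[leRHS]invrK lef_pV2 ?posrE ?invr_gt0 ?exprn_gt0//.
apply/ltW/upper_nthrootP; apply: (leq_trans _ (ltnW (ltn_expl m (ltnSn 1)))).
exact: leq_trans (leqnSn _) Mm.
Qed.

(** * Decrements and objective values along the full Newton steps *)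

Theorem theorem5p12
  (R : realType) (L S : nat)
  (* network *)
  (node : finType) (tail head : 'I_L -> node) (route : 'I_S -> {set 'I_L})
  (c : 'cV[R]_L)
  (c_gt0 : forall l, 0 < c l 0)
  (route_neq0 : forall j, exists l, l \in route j)
  (link_used : forall l, exists j, l \in route j)
  (net_connected : links_connected tail head)
  (* utilities and objective *)
  (U : 'I_S -> R -> R)
  (U_concave : forall i, strictly_concave_on `]0, +oo[ (U i))
  (U_nondecr : forall i, nondecreasing_on `]0, +oo[ (U i))
  (U_sc : forall i, self_concordant_on `]0, +oo[ (fun t => - U i t))
  (mu : R) (mu_ge1 : 1 <= mu)
  (f : 'cV[R]_(S + L) -> R) (f_def : f = objective U mu)
  (* inexact Newton method *)
  (x dx dxt : nat -> 'cV[R]_(S + L)) (wt : nat -> 'cV[R]_L)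
  (d theta : nat -> R)
  (x_feasible : forall k, feasible route c (x k))
  (x_step : forall k, x k.+1 = x k + d k *: dxt k)
  (dx_newton : forall k,
     is_newton_direction (constraint_mx R route) f (x k) (dx k))
  (dxt_def : forall k, dxt k = inexact_direction route f (x k) (wt k))
  (* error in the direction *)
  (p epsilon : R) (p_gt0 : 0 < p) (p_lt1 : p < 1) (epsilon_gt0 : 0 < epsilon)
  (direction_error : forall k,
     `|quad (hessian f (x k)) (dx k - dxt k)|
       <= p ^+ 2 * quad (hessian f (x k)) (dxt k) + epsilon)
  (* stepsize rule *)
  (V b : R) (V_gt0 : 0 < V) (V_lt : V < 267 / 1000)
  (b_gt : (V + 1) / (2 * V + 1) < b) (b_lt1 : b < 1)
  (theta_error : forall k,
     `|decrement f (x k) (dxt k) - theta k| <= (b^-1 - 1) * (1 + V))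
  (d_def : forall k, d k = stepsize b V theta k)
  (kbar : nat)
  (kbar_lt : theta kbar < V)
  (kbar_first : forall k, (k < kbar)%N -> V <= theta k)
  (* constants of the theorem *)
  (phi xi v taubar delta : R)
  (phi_gt0 : 0 < phi) (phi_le : phi <= 267 / 1000)
  (xi_def : xi = (phi * p + Num.sqrt epsilon)
                   / (1 - p - phi - Num.sqrt epsilon)
                 + (2 * phi * Num.sqrt epsilon + epsilon)
                   / (1 - p - phi - Num.sqrt epsilon) ^+ 2)
  (v_def : v = 1 / (1 - p - phi - Num.sqrt epsilon) ^+ 2)
  (taubar_gt0 : 0 < taubar)
  (taubar_bound : `|decrement f (x kbar) (dxt kbar) - theta kbar| <= taubar)
  (rel1 : (1 + p) * (theta kbar + taubar) + Num.sqrt epsilon <= phi)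
  (rel2 : v * (68 / 100) ^+ 2 + xi <= 68 / 100)
  (rel3 : (68 / 100 + Num.sqrt epsilon) / (1 - p) <= 1)
  (rel4 : p + Num.sqrt epsilon <= 1 - (4 * phi ^+ 2) `^ (1 / 4) - phi)
  (delta_ge0 : 0 <= delta) (delta_lt : delta < 1 / 2)
  (rel5 : xi + v * xi <= delta / (4 * v)) :
  (forall m : nat, (1 <= m)%N ->
     decrement f (x (kbar + m)%N) (dx (kbar + m)%N)
       <= 1 / (2 ^+ (2 ^ m)%N * v) + xi
          + delta / v * ((2 ^+ (2 ^ m - 1)%N - 1) / 2 ^+ (2 ^ m)%N))
  /\
  (limn_esup (fun m => (f (x (kbar + m)%N))%:E)
     - optimal_value f (feasible route c) <= (xi + delta / (2 * v))%:E)%E.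
Proof.
pose e : R := Num.sqrt epsilon.
pose G (i : 'I_(S + L)) : R -> R := neg_utility U i - (fun t => mu * ln t).
pose G2 (i : 'I_(S + L)) : R -> R := derive1n 2 (neg_utility U i) + (fun t => mu * t ^- 2).
have sc (i : 'I_(S + L)) : self_concordant_jet (G i)
    (derive1n 1 (neg_utility U i) - (fun t => mu * t^-1)) (G2 i)
    (derive1n 3 (neg_utility U i) - (fun t => 2 * mu * t ^- 3)).
  exact: objective_jet.
have fE : f = fun y : 'cV[R]_(S + L) => \sum_i G i (y i 0).
  by rewrite f_def objective_separable.
have e0 : 0 < e by rewrite sqrtr_gt0.
have eE : epsilon = e ^+ 2 by rewrite sqr_sqrtr// ltW.
have p1 : 0 < 1 - p by rewrite subr_gt0.
pose D := 1 - p - phi - e.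
have phi2 : 0 < 4 * phi ^+ 2 by rewrite mulr_gt0// exprn_gt0.
(* The relation [rel4] says [D >= (4 phi^2)^(1/4)]; its fourth power yields [2 phi <= D^2]. *)
have D_ge : (4 * phi ^+ 2) `^ (1 / 4) <= D.
  by rewrite /D; move: rel4; rewrite -/e; lra.
have D0 : 0 < D by apply: lt_le_trans D_ge; rewrite powR_gt0.
have phi_D : 2 * phi <= D ^+ 2.
  have : 4 * phi ^+ 2 <= D ^+ 4.
    have -> : 4 * phi ^+ 2 = ((4 * phi ^+ 2) `^ (1 / 4)) ^+ 4.
      rewrite -[RHS]powR_mulrn ?powR_ge0// -powRrM mul1r mulVf ?pnatr_eq0//.
      by rewrite powRr1// ltW.
    by rewrite ler_pXn2r ?nnegrE ?powR_ge0// ltW.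
  have -> : 4 * phi ^+ 2 = (2 * phi) ^+ 2 by ring.
  rewrite -[4%N]/(2 * 2)%N exprM ler_pXn2r ?nnegrE ?exprn_ge0 ?(ltW D0)//.
  by rewrite mulr_ge0// ltW.
have xiE : xi = (phi * p + e) / D + (2 * phi * e + e ^+ 2) / D ^+ 2.
  by rewrite xi_def -/e eE.
have x0 k : positive_cV (x k) by have [] := x_feasible k.
have Ax k : constraint_mx R route *m x k = c by have [] := x_feasible k.
pose N k := local_norm G2 (x k).
have decE k u : decrement f (x k) u = N k u.
  by rewrite fE; exact: (decrement_separable _ _ _ _ sc).
have quadE k u : quad (hessian f (x k)) u = N k u ^+ 2.
  rewrite fE (quad_hessian_separable _ _ _ _ sc)// sqr_sqrtr//.
  by apply: sumr_ge0 => i _; exact: sqr_ge0.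
have N0 k u : 0 <= N k u by rewrite sqrtr_ge0.
(* The error condition under the root: [sqrt (p^2 t^2 + e^2) <= p t + e]. *)
have gam k : N k (dx k - dxt k) <= p * N k (dxt k) + e.
  have := direction_error k; rewrite !quadE ger0_norm ?sqr_ge0// eE => H.
  rewrite -(@ler_pXn2r _ 2) ?nnegrE ?addr_ge0 ?mulr_ge0 ?N0 ?(ltW e0) ?(ltW p_gt0)//.
  apply: (le_trans H); rewrite sqrrD exprMn -addrA lerD2l lerDr.
  by rewrite mulrn_wge0// !mulr_ge0 ?N0 ?(ltW e0) ?(ltW p_gt0).
have dxt_le k : N k (dxt k) * (1 - p) <= N k (dx k) + e.
  have := local_norm_triangle G2 (x k) (dx k) (- (dx k - dxt k)).
  rewrite local_normN opprB addrCA subrr addr0 -/(N k _) -/(N k _) -/(N k _).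
  by have := gam k; lra.
have dx_le k : N k (dx k) <= (1 + p) * N k (dxt k) + e.
  have := local_norm_triangle G2 (x k) (dxt k) (dx k - dxt k).
  rewrite addrCA subrr addr0 -/(N k _) -/(N k _) -/(N k _).
  by have := gam k; lra.
have xS m : x (kbar + m.+1)%N = x (kbar + m)%N + dxt (kbar + m)%N.
  rewrite addnS x_step d_def /stepsize.
  (* The index [kbar] is itself among those up to [kbar + m] and violates [V <= theta], so the step
     is 1. *)
  case: forallP => [/(_ (Ordinal (leq_addr m kbar : (kbar < (kbar + m).+1)%N)))/=|_].
    by rewrite leNgt kbar_lt.
  by rewrite scale1r.
pose a m := N (kbar + m)%N (dx (kbar + m)%N).
have a_phi : a 0%N <= phi.
  apply: le_trans rel1; rewrite /a addn0 -/e.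
  apply: (le_trans (dx_le kbar)); rewrite lerD2r ler_pM2l ?addr_gt0//.
  have := taubar_bound; rewrite decE => /ler_normlW; lra.
have a_step m B : a m <= B -> 0 < 1 - p - B - e ->
    a m.+1 <= (a m + e) ^+ 2 / (1 - p - B - e) ^+ 2
              + (p * a m + e) / (1 - p - B - e).
  move=> aB B0; set k := (kbar + m)%N.
  (* From [t (1 - p) <= a m + e <= B + e < 1 - p]. *)
  have lt1 : N k (dxt k) < 1.
    rewrite -(ltr_pM2r p1) mul1r (le_lt_trans (dxt_le k))//.
    by move: aB; rewrite /a -/k; lra.
  apply: (inexact_decrement_bound p e (a m) B (N k (dxt k))) => //.
  have [nk _] := dx_newton k; have [nk1 Ak1] := dx_newton (kbar + m.+1)%N.
  rewrite fE in nk nk1; rewrite xS -/k in nk1.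
  have xk1 : positive_cV (x k + dxt k) by rewrite -xS.
  have := inexact_newton_step _ _ _ _ sc _ _ _ _ _ _ (x0 k) xk1 nk nk1 Ak1 lt1.
  rewrite -xS -/(N _ _) -/(N _ _) -/(N _ _) => /le_trans; apply.
  by rewrite lerD2r gam.
have bound := decrement_sequence_bound _ _ _ _ _ _ p_gt0 e0 phi_gt0 D0 phi_D
  xiE v_def rel2 delta_ge0 delta_lt rel5 a (fun m => N0 _ _) a_phi a_step.
have half := decrement_bound_le_half _ _ _ _ _ _ p_gt0 e0 phi_gt0 D0
  xiE v_def delta_ge0 delta_lt rel5.
split; first by move=> m m1; rewrite decE; exact: bound.
pose bd m : R := 1 / (2 ^+ (2 ^ m)%N * v) + xi
         + delta / v * ((2 ^+ (2 ^ m - 1)%N - 1) / 2 ^+ (2 ^ m)%N).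
(* The decrement is at most 1/2, so its square is below the decrement and hence below [bd m].
   Uniformity in [y] gives both finiteness of the optimal value and the estimate [fle]. *)
have gap m y : (1 <= m)%N -> feasible route c y ->
    f (x (kbar + m)%N) - bd m <= f y.
  move=> m1 [y0 Ay]; set k := (kbar + m)%N.
  have ah : a m <= 1 / 2 by rewrite (le_trans (bound m m1))// half.
  have [nk _] := dx_newton k; rewrite fE in nk *.
  have Axy : constraint_mx R route *m x k = constraint_mx R route *m y.
    by rewrite Ax Ay.
  apply: le_trans (suboptimality_le _ _ _ _ sc _ _ _ _ _ (x0 k) y0 Axy nk ah).
  rewrite lerD2l lerN2 (le_trans _ (bound m m1))//.
  rewrite -/(N k _) -/(a m) expr2 ler_piMl ?N0//; lra.
(* Finiteness allows the optimal value to be moved across the extended-real inequality. *)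
have fs_fin : optimal_value f (feasible route c) \is a fin_num.
  rewrite fin_numElt; apply/andP; split.
    apply: (@lt_le_trans _ _ (f (x (kbar + 1)%N) - bd 1%N)%:E); first by rewrite ltNyr.
    by apply: le_ereal_inf_tmp => _ [y fy <-]; rewrite lee_fin gap.
  apply: (@le_lt_trans _ _ (f (x 0%N))%:E); last by rewrite ltry.
  by apply: ereal_inf_lbound; exists (x 0%N).
move: (fs_fin) => /fineK; set fs := fine _ => fsE.
have fle m : (1 <= m)%N -> f (x (kbar + m)%N) <= fs + bd m.
  move=> m1; rewrite -lerBlDr -lee_fin fsE.
  by apply: le_ereal_inf_tmp => _ [y fy <-]; rewrite lee_fin gap.
rewrite -fsE leeBlDr// -EFinD.
apply/lee_addgt0Pr => eta eta0; rewrite -EFinD.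
have [M [M1 MP]] := inv_double_exp_small eta eta0.
apply: (limn_esup_le_tail _ _ M) => m Mm.
have m1 := leq_trans M1 Mm.
rewrite lee_fin.
have := decrement_bound_le_limit _ _ _ xi _ _ p_gt0 e0 phi_gt0 D0 v_def
  delta_ge0 m m1.
by have := fle m m1; have := MP m Mm; rewrite -/(bd m); lra.
Qed.
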